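(* Let $r\ge2$, and for $i=1,\dots,r$ let $A_i=R_i/\mathfrak a_i$ be a standard graded ring with $\mathfrak a_i\subseteq(\mathbf x_i)^2$ a homogeneous ideal. Let $L=\sum_{1\le i\ne j\le r}\mathbf x_i\cap\mathbf x_j\subset Q$. For every $t\ge1$ and every integer $s$ there is an isomorphism of $K$-vector spaces $$[\operatorname{Tor}_t^Q(A_1\times_K\cdots\times_K A_r,K)]_s\cong\begin{cases}0&\text{if } s\le t,\\ \bigoplus_{i=1}^r[\operatorname{Tor}_t^Q(A_i,K)]_{t+1}\oplus[\operatorname{Tor}_t^Q(Q/L,K)]_{t+1}&\text{if } s=t+1,\\ \bigoplus_{i=1}^r[\operatorname{Tor}_t^Q(A_i,K)]_s&\text{if } s\ge t+2.\end{cases}$$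
   Context: $K$ is an arbitrary field. For $i=1,\dots,r$, $R_i=K[x_{i,1},\dots,x_{i,n_i}]$ ($n_i\ge1$) is a standard graded polynomial ring with irrelevant ideal $\mathbf x_i=(x_{i,1},\dots,x_{i,n_i})$, and $Q=R_1\otimes_K\cdots\otimes_K R_r$. The symbols $\mathbf x_i,\mathfrak a_i$ also denote the extended ideals in $Q$. Each $A_i$ is a $Q$-module via $A_i\cong Q/(\mathfrak a_i+\sum_{j\ne i}\mathbf x_j)$. With canonical projections $\pi_i:A_i\to K$, the fiber product is $A_1\times_K\cdots\times_K A_r=\{(a_1,\dots,a_r)\in A_1\oplus\cdots\oplus A_r\mid\pi_i(a_i)=\pi_j(a_j)\ \forall i,j\}$, a quotient of $Q$. *)

(* Defs.v *)
From HB Require Import structures.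
From mathcomp Require Import all_boot all_order all_algebra.
From mathcomp Require Import mpoly boolp.

Set Implicit Arguments.
Unset Strict Implicit.
Unset Printing Implicit Defensive.

Import GRing.Theory.
Import Quotient.
Local Open Scope ring_scope.
Local Open Scope quotient_scope.

(** Over a ring, the structure [submodClosed] of the library does not record
    closure under opposites, hence this packaging. *)
Record submodule (R : pzRingType) (M : lmodType R) := Submodule {
  smem :> {pred M};
  smem_closed : submod_closed smem
}.

HB.instance Definition _ (R : pzRingType) (M : lmodType R) (S : submodule M) :=
  GRing.isSubmodClosed.Build R M (smem S) (smem_closed S).

Notation quo S := {quot (smem S)}.

Section Submodules.
Context {R : pzRingType} {M : lmodType R}.
Implicit Types (S T : submodule M).

Definition subm S : Type := {x : M | x \in smem S}.
HB.instance Definition _ S := SubChoice.on (subm S).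
HB.instance Definition _ S := [SubChoice_isSubLmodule of subm S by <:].

Definition qscale S (c : R) (x : quo S) : quo S := \pi_(quo S) (c *: repr x).

Lemma pi_qscale S c (m : M) : qscale c (\pi_(quo S) m) = \pi_(quo S) (c *: m).
Proof.
apply/eqP; rewrite -idealrBE -scalerBr rpredZ //.
by rewrite idealrBE reprK.
Qed.

Fact qscaleA S a b (x : quo S) : qscale a (qscale b x) = qscale (a * b) x.
Proof. by rewrite {2 3}/qscale pi_qscale scalerA. Qed.

Fact qscale1 S : left_id 1 (@qscale S).
Proof. by move=> x; rewrite /qscale scale1r reprK. Qed.

Fact qscaleDr S : right_distributive (@qscale S) +%R.
Proof.
move=> a x y; rewrite -[x]reprK -[y]reprK -raddfD !pi_qscale.
by rewrite scalerDr raddfD.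
Qed.

Fact qscaleDl S (x : quo S) : {morph (@qscale S)^~ x : a b / a + b}.
Proof. by move=> a b; rewrite /qscale scalerDl raddfD. Qed.

HB.instance Definition _ S := GRing.Zmodule_isLmodule.Build R (quo S)
  (@qscaleA S) (@qscale1 S) (@qscaleDr S) (@qscaleDl S).

Definition qproj S T (ST : {subset S <= T}) (x : quo S) : quo T :=
  \pi_(quo T) (repr x).

Lemma qproj_pi S T (ST : {subset S <= T}) (m : M) :
  qproj ST (\pi_(quo S) m) = \pi_(quo T) m.
Proof.
by apply/eqP; rewrite -idealrBE; apply: ST; rewrite idealrBE reprK.
Qed.

Fact qproj_is_linear S T (ST : {subset S <= T}) : linear (qproj ST).
Proof.
move=> c x y; rewrite -[x]reprK -[y]reprK.
rewrite [c *: _]pi_qscale -raddfD !qproj_pi raddfD.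
by rewrite [X in _ = X + _]pi_qscale.
Qed.

HB.instance Definition _ S T (ST : {subset S <= T}) :=
  GRing.isLinear.Build R (quo S) (quo T) _ (qproj ST) (qproj_is_linear ST).

Definition span_pred (G : M -> Prop) : {pred M} :=
  fun x => `[< forall S, (forall g, G g -> g \in S) -> x \in S >].

Fact span_submod_closed G : submod_closed (span_pred G).
Proof.
split=> [|c x y /asboolP xG /asboolP yG]; apply/asboolP => S GS.
  exact: rpred0.
by rewrite rpredD ?rpredZ // ?xG ?yG.
Qed.

Definition span G : submodule M := Submodule (span_submod_closed G).

Lemma mem_span (G : M -> Prop) g : G g -> g \in span G.
Proof. by move=> Gg; apply/asboolP => S GS; apply: GS. Qed.

Lemma span_sub (G : M -> Prop) S :
  (forall g, G g -> g \in S) -> {subset span G <= S}.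
Proof. by move=> GS x /asboolP; apply. Qed.

End Submodules.

Section DirectSum.
Context {R : pzRingType} {I : finType} (V : I -> lmodType R).

Definition dirsum : Type := forall i, V i.

Implicit Types (x y z : dirsum).

HB.instance Definition _ := gen_eqMixin dirsum.
HB.instance Definition _ := gen_choiceMixin dirsum.

Definition ds_add x y : dirsum := fun i => x i + y i.
Definition ds_opp x : dirsum := fun i => - x i.
Definition ds_scale (c : R) x : dirsum := fun i => c *: x i.

Fact ds_addA : associative ds_add.
Proof. by move=> x y z; apply/functional_extensionality_dep => i; apply: addrA. Qed.
Fact ds_addC : commutative ds_add.
Proof. by move=> x y; apply/functional_extensionality_dep => i; apply: addrC. Qed.
Fact ds_add0 : left_id (fun=> 0) ds_add.
Proof. by move=> x; apply/functional_extensionality_dep => i; apply: add0r. Qed.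
Fact ds_addN : left_inverse (fun=> 0) ds_opp ds_add.
Proof. by move=> x; apply/functional_extensionality_dep => i; apply: addNr. Qed.

HB.instance Definition _ :=
  GRing.isZmodule.Build dirsum ds_addA ds_addC ds_add0 ds_addN.

Fact ds_scaleA a b x : ds_scale a (ds_scale b x) = ds_scale (a * b) x.
Proof. by apply/functional_extensionality_dep => i; apply: scalerA. Qed.
Fact ds_scale1 : left_id 1 ds_scale.
Proof. by move=> x; apply/functional_extensionality_dep => i; apply: scale1r. Qed.
Fact ds_scaleDr : right_distributive ds_scale +%R.
Proof. by move=> a x y; apply/functional_extensionality_dep => i; apply: scalerDr. Qed.
Fact ds_scaleDl x : {morph ds_scale^~ x : a b / a + b}.
Proof. by move=> a b; apply/functional_extensionality_dep => i; apply: scalerDl. Qed.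

HB.instance Definition _ := GRing.Zmodule_isLmodule.Build R dirsum
  ds_scaleA ds_scale1 ds_scaleDr ds_scaleDl.

End DirectSum.

Definition isomorphic (R : pzRingType) (V W : lmodType R) : Prop :=
  exists f : {linear V -> W}, bijective f.

Section FiberProduct.
Context {R : pzRingType} {I : finType} {V : I -> lmodType R} {T : lmodType R}.
Variable f : forall i, {linear V i -> T}.

Definition fiber_pred : {pred dirsum V} :=
  fun x => [forall i, forall j, f i (x i) == f j (x j)].

Lemma fiberP x : reflect (forall i j, f i (x i) = f j (x j)) (x \in fiber_pred).
Proof.
by apply: (iffP forallP) => xf i; [move=> j; apply/eqP/(forallP (xf i))
  | apply/forallP=> j; apply/eqP].
Qed.

Fact fiber_submod_closed : submod_closed fiber_pred.
Proof.
split=> [|c x y /fiberP xf /fiberP yf];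
  apply/fiberP => i j; first by rewrite !raddf0.
by rewrite !linearP (xf i j) (yf i j).
Qed.

Definition fiber : submodule (dirsum V) := Submodule fiber_submod_closed.

End FiberProduct.

Section Graded.
Context {K : fieldType} {N : nat}.
Local Notation Q := {mpoly K[N]}.

Definition restr (M : lmodType Q) : Type := M.

Section Restr.
Variable M : lmodType Q.
HB.instance Definition _ := GRing.Zmodule.on (restr M).

Definition rscale (c : K) (x : restr M) : restr M := c%:MP *: (x : M).

Fact rscaleA a b x : rscale a (rscale b x) = rscale (a * b) x.
Proof. by rewrite /rscale scalerA mpolyCM. Qed.
Fact rscale1 : left_id 1 rscale.
Proof. by move=> x; rewrite /rscale scale1r. Qed.
Fact rscaleDr : right_distributive rscale +%R.
Proof. by move=> a x y; apply: scalerDr. Qed.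
Fact rscaleDl x : {morph rscale^~ x : a b / a + b}.
Proof. by move=> a b; rewrite /rscale mpolyCD scalerDl. Qed.

HB.instance Definition _ := GRing.Zmodule_isLmodule.Build K (restr M)
  rscaleA rscale1 rscaleDr rscaleDl.
End Restr.

(** A [Q]-module with a family of [K]-subspaces indexed by degree. That the
    module is the direct sum of its pieces is not part of the data: only
    subquotients and finite direct sums of [Q] by homogeneous submodules, with
    the induced pieces, are ever used. *)
Record gmod := Gmod {
  gcar :> lmodType Q;
  gdeg : int -> submodule (restr gcar)
}.

Definition piece (M : gmod) (s : int) : lmodType K := subm (gdeg M s).

Section Free.
Variable d : int.

Definition gring_deg : {pred restr Q^o} :=
  fun p => if d is Posz n then (p : Q) \is n.-homog else p == 0.

Fact gring_deg_closed : submod_closed gring_deg.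
Proof.
rewrite /gring_deg; case: d => n; split=> [|c x y].
- exact: dhomog0.
- rewrite !unfold_in => xn yn; apply: dhomogD yn.
  by rewrite /GRing.scale /= /rscale /GRing.scale /= mul_mpolyC; apply: dhomogZ.
- by rewrite unfold_in.
- by rewrite !unfold_in => /eqP-> /eqP->; rewrite scaler0 addr0.
Qed.

End Free.

Definition gring : gmod := @Gmod Q^o (fun d => Submodule (gring_deg_closed d)).

Section GSub.
Variables (M : gmod) (S : submodule M).

Definition gsub_deg (d : int) : {pred restr (subm S)} :=
  fun x => (val (x : subm S) : restr M) \in gdeg M d.

Fact gsub_deg_closed d : submod_closed (gsub_deg d).
Proof.
split=> [|c x y xd yd]; first exact: (rpred0 (smem (gdeg M d))).
change ((c *: (val (x : subm S) : restr M) + val (y : subm S)) \in gdeg M d).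
exact: ((smem_closed (gdeg M d)).2 c _ _ xd yd).
Qed.

Definition gsub : gmod := @Gmod (subm S) (fun d => Submodule (gsub_deg_closed d)).

Definition gquot_deg (d : int) : {pred restr (quo S)} :=
  fun x => `[< exists2 m : M, (m : restr M) \in gdeg M d & x = \pi_(quo S) m >].

Fact gquot_deg_closed d : submod_closed (gquot_deg d).
Proof.
split=> [|c x y /asboolP[m md ->] /asboolP[m' md' ->]]; apply/asboolP.
  by exists 0; rewrite ?raddf0 ?rpred0.
exists (c *: (m : restr M) + m').
  exact: ((smem_closed (gdeg M d)).2 c _ _ md md').
by rewrite raddfD; congr (_ + _); apply: pi_qscale.
Qed.

Definition gquot : gmod := @Gmod (quo S) (fun d => Submodule (gquot_deg_closed d)).
End GSub.
Arguments gsub M S : clear implicits.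
Arguments gquot M S : clear implicits.

Section GSum.
Variables (I : finType) (M : I -> gmod).

Definition gsum_deg (d : int) : {pred restr (dirsum M)} :=
  fun x => [forall i, ((x : dirsum M) i : restr (M i)) \in gdeg (M i) d].

Fact gsum_deg_closed d : submod_closed (gsum_deg d).
Proof.
split=> [|c x y /forallP xd /forallP yd]; apply/forallP => i.
  exact: rpred0.
exact: ((smem_closed (gdeg (M i) d)).2 c _ _ (xd i) (yd i)).
Qed.

Definition gsum : gmod := @Gmod (dirsum M) (fun d => Submodule (gsum_deg_closed d)).
End GSum.

(** The twist [M(-e)], whose piece of degree [d] is [[M]_(d - e)]. *)
Definition gtwist (M : gmod) (e : int) : gmod :=
  @Gmod M (fun d => gdeg M (d - e)).

(** A resolution of [M] by finitely generated graded free modules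
    [F_t = (+)_(j < rk t) Q(- dg t j)], written as row vectors. The
    differential [F_(t+1) -> F_t] is right multiplication by [dif t]. *)
Record gres (M : gmod) := Gres {
  rk : nat -> nat;
  dg : forall t, 'I_(rk t) -> int;
  dif : forall t, 'M[Q]_(rk t.+1, rk t);
  aug : {linear 'rV[Q]_(rk 0) -> M};
  dif_homog : forall t i j,
    (dif t i j : restr Q^o) \in gdeg gring (dg i - dg j);
  aug_homog : forall j, (aug (delta_mx 0 j) : restr M) \in gdeg M (dg j);
  aug_surj : forall m, exists u, m = aug u;
  aug_exact : forall u, aug u = 0 <-> exists v, u = v *m dif 0;
  dif_exact : forall t (u : 'rV_(rk t.+1)), u *m dif t = 0 <-> exists v, u = v *m dif t.+1
}.

Section Tor.
Variables (M L : gmod) (F : gres L).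

(** [M (x)_Q F_t], that is [(+)_(j < rk t) M(- dg t j)]. *)
Definition tens (t : nat) : gmod := gsum (fun j => gtwist M (dg (g := F) (t := t) j)).

Definition tdif t (x : tens t.+1) : tens t :=
  fun k => \sum_j dif F t j k *: (x j : M).

Fact tdif_is_linear t : linear (@tdif t).
Proof.
move=> c x y; apply/functional_extensionality_dep => k.
have -> : (c *: tdif x + tdif y) k = c *: (tdif x k : M) + (tdif y k : M) by [].
rewrite /tdif scaler_sumr -big_split; apply: eq_bigr => j _ /=.
have -> : (c *: x + y) j = c *: (x j : M) + (y j : M) by [].
by rewrite scalerDr !scalerA mulrC.
Qed.

HB.instance Definition _ t := GRing.isLinear.Build Q (tens t.+1) (tens t) _
  (@tdif t) (@tdif_is_linear t).

Definition cycles_pred (t : nat) : {pred tens t} :=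
  match t return {pred tens t} with
  | 0 => fun=> true
  | t'.+1 => fun x => tdif x == 0
  end.

Fact cycles_closed t : submod_closed (@cycles_pred t).
Proof.
case: t => [|t]; split=> //= [|c x y]; rewrite !unfold_in ?raddf0 //.
by move=> /eqP xZ /eqP yZ; rewrite linearP /= xZ yZ scaler0 addr0.
Qed.

Definition cycles t : submodule (tens t) := Submodule (cycles_closed t).

Definition boundaries_pred (t : nat) : {pred subm (cycles t)} :=
  fun z => `[< exists x, val z = tdif x >].

Fact boundaries_closed t : submod_closed (@boundaries_pred t).
Proof.
split=> [|c z w /asboolP[x zx] /asboolP[y wy]]; apply/asboolP.
  by exists 0; rewrite !raddf0.
by exists (c *: x + y); rewrite (tdif_is_linear c x y) -zx -wy.
Qed.

Definition boundaries t : submodule (subm (cycles t)) := Submodule (boundaries_closed t).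

(** [Tor_t^Q(M, L) = H_t(M (x)_Q F)], for a graded free resolution [F] of [L];
    the choice of [F] is immaterial up to isomorphism. *)
Definition Tor (t : nat) : gmod := gquot (gsub (tens t) (cycles t)) (boundaries t).
End Tor.

End Graded.
Arguments gsub {K N} M S.
Arguments gquot {K N} M S.

Section Ideals.
Context {K : fieldType} {n : nat}.
Local Notation R := {mpoly K[n]}.

Definition irrelevant : submodule R^o :=
  span (fun p : R^o => exists j, p = 'X_j).

Definition ideal_mul (a b : submodule R^o) : submodule R^o :=
  span (fun p : R^o => exists f g : R, [/\ f \in a, g \in b & p = f * g]).

Fact ideal_mul_sub a b : {subset ideal_mul a b <= b}.
Proof.
apply: span_sub => _ [f [g [_ gb ->]]].
exact: (@rpredZ _ _ (smem b) f g gb).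
Qed.

Definition homogeneous_ideal (a : submodule R^o) : Prop :=
  forall p d, p \in a -> pihomog mdeg d p \in a.
End Ideals.

Section Setting.
Context (K : fieldType) {r : nat} (n : 'I_r -> nat).

(** The variable [x_(i,j)] of [Q] has index [tagnat.Rank i j]. *)
Local Notation N := (\sum_i n i)%N.
Local Notation R i := {mpoly K[n i]}.
Local Notation Q := {mpoly K[N]}.

Definition embed (i : 'I_r) (f : R i) : Q :=
  f \mPo [tuple 'X_(tagnat.Rank i j) | j < n i].

Definition extended (i : 'I_r) (a : submodule (R i)^o) : submodule Q^o :=
  span (fun p : Q^o => exists2 f : R i, f \in a & p = embed f).

(** The extension to [Q] of the irrelevant ideal of [R_i]. *)
Definition xx (i : 'I_r) : submodule Q^o := extended (@irrelevant K (n i)).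

Fact embed_irrelevant i (f : R i) :
  f \in (irrelevant : submodule (R i)^o) ->
  embed f \in (irrelevant : submodule Q^o).
Proof.
pose P : {pred (R i)^o} := fun g => embed g \in (irrelevant : submodule Q^o).
have PZ : submod_closed P.
  split=> [|c g h gP hP]; first by rewrite unfold_in /P /embed comp_mpoly0; apply: rpred0.
  rewrite unfold_in /P /embed comp_mpolyD rmorphM.
  exact: ((smem_closed irrelevant).2 (embed c) _ _ gP hP).
move: f; apply: (span_sub (S := Submodule PZ)) => _ [j ->].
rewrite unfold_in /= /P /embed comp_mpolyXU -tnth_nth tnth_mktuple.
by apply: mem_span; exists (tagnat.Rank i j).
Qed.

Fact xx_irrelevant i : {subset xx i <= (irrelevant : submodule Q^o)}.
Proof. by apply: span_sub => _ [f firr ->]; apply: embed_irrelevant. Qed.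

Definition residue : gmod := gquot gring (irrelevant : submodule Q^o).

Definition ideal_L : submodule Q^o :=
  span (fun p : Q^o => exists i j, [/\ i != j, p \in xx i & p \in xx j]).

Section Factors.
Variable a : forall i, submodule (R i)^o.

Definition ideal_A (i : 'I_r) : submodule Q^o :=
  span (fun p : Q^o =>
    p \in extended (a i) \/ exists2 j, j != i & p \in xx j).

(** [A_i = R_i / a_i] as the [Q]-module [Q / (a_i + \sum_(j != i) x_j)]. *)
Definition factor (i : 'I_r) : gmod := gquot gring (ideal_A i).

Hypothesis a_sq : forall i,
  {subset a i <= ideal_mul (@irrelevant K (n i)) (@irrelevant K (n i))}.

Lemma ideal_A_irrelevant i : {subset ideal_A i <= (irrelevant : submodule Q^o)}.
Proof.
apply: span_sub => p [|[j _]]; last exact: xx_irrelevant.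
apply: span_sub => _ [f /a_sq fa ->]; apply: embed_irrelevant.
exact: ideal_mul_sub fa.
Qed.

(** [A_1 x_K ... x_K A_r], with [K] the residue field of [Q]. *)
Definition fiber_product : gmod :=
  gsub (gsum factor)
    (fiber (fun i => qproj (ideal_A_irrelevant (i := i)))).
End Factors.
End Setting.

(* Main.v *)
From HB Require Import structures.
Require Import Defs.
From mathcomp Require Import all_boot all_order all_algebra.
From mathcomp Require Import mpoly boolp.
From mathcomp Require classical_sets.

Set Implicit Arguments.
Unset Strict Implicit.
Unset Printing Implicit Defensive.

Import Order.TTheory GRing.Theory Num.Theory.
Import Quotient.
Local Open Scope ring_scope.
Local Open Scope quotient_scope.

(** Write P for the fiber product, m for the irrelevant ideal of Q, X_i for
    the ideal generated by the variables outside the i-th group, and A_i for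
    the ideal whose quotient is the i-th factor. Then X_i <= A_i <= m, the ring
    P is Q/I with I the intersection of the A_i, and L is the intersection of
    the X_i. Since a_i starts in degree 2, an element of A_i of degree at most
    1 lies in X_i; hence I vanishes in degrees at most 1.

    All modules that occur are quotients Q/J, so every Tor is computed from
    vectors over Q: [Tor_t(Q/J, K)]_s is the space of vectors z of degree s in
    Q (x) F_t with dz in J, modulo the vectors dv + (vector over J)
    ([tor_presentation]). Two facts about an arbitrary graded resolution F of
    K drive the argument.

    - Koszul property ([koszul]): if J is generated by variables, then
      [Tor_t(Q/J, K)]_s = 0 for s <> t. One adds the variables one at a time,
      each being a nonzerodivisor modulo the previous ones.
    - Concentration ([concentrated]): a subquotient J/J0 of Q that vanishes in
      degree s - t has [Tor_t(J/J0, K)]_s = 0. As F need not be minimal, this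
      is derived from the Koszul property of K: for every e <> t the constant
      part of F in degree e is exact at F_t, so its splittings move a cycle
      within its homology class until only components against generators of
      degree t are left, and these lie in degree s - t.

    Now let t >= 1. The boundary of a cycle modulo I is a cycle over I in
    position t - 1; for s <= t it lives in degree s - (t - 1) <= 1 where I
    vanishes, so it bounds over I and [Tor_t(P, K)]_s = 0 ([fiber_bnd_low]).

    For the other degrees consider 0 -> P -> sum of the Q/A_i -> K^(r-1) -> 0.
    Its arrows need not be formed: classes of the factors, or the vectors
    witnessing that a class vanishes in every factor, are first corrected by
    boundaries so as to agree modulo m, which is possible when
    Tor_t(K, K)_s = 0, respectively Tor_(t+1)(K, K)_s = 0, and are then glued
    to one vector over Q ([glue]). So the map from Tor_t(P, K)_s to the sum of
    the Tor_t(Q/A_i, K)_s is onto for s <> t ([fiber_cyc_lift]) and injective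
    for s <> t + 1 ([fiber_bnd]).

    For s = t + 1 the kernel of this map is Tor_t(Q/L, K)_(t+1). The map from
    the latter to Tor_t(P, K) is injective by concentration, as I/L vanishes
    in degree 1 ([L_bnd]). It goes to zero in each factor, because it passes
    through Tor_t(Q/X_i, K)_(t+1) = 0 ([L_cyc_bnd_A]). It fills the kernel,
    because boundaries agreeing modulo m glue to a vector that is a cycle
    modulo every X_i, that is modulo L ([fiber_bnd_L]). The resulting exact
    sequence of vector spaces splits. *)

(** * Submodules, quotients and ideals *)

Lemma idealM (R : pzRingType) (J : submodule R^o) (c q : R) :
  (q : R^o) \in J -> (c * q : R^o) \in J.
Proof. exact: (@rpredZ _ _ (smem J) c q). Qed.

Lemma quot_eq0 (R : pzRingType) (M : lmodType R) (S : submodule M) (x : M) :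
  (\pi_(quo S) x = 0) <-> x \in S.
Proof.
rewrite -[0](raddf0 \pi_(quo S)); split=> [/eqP|xS]; last apply/eqP.
  by rewrite -idealrBE subr0.
by rewrite -idealrBE subr0.
Qed.

Section Projections.
Context {R : pzRingType} {M : lmodType R} (S : submodule M).

Definition quo_proj (x : M) : quo S := \pi_(quo S) x.

Fact quo_proj_linear : linear quo_proj.
Proof. by move=> c x y; rewrite /quo_proj raddfD [X in _ = X + _]pi_qscale. Qed.
HB.instance Definition _ := GRing.isLinear.Build R M (quo S) _ quo_proj quo_proj_linear.

End Projections.

Section DirsumMap.
Context {R : pzRingType} {Z : lmodType R} {I : finType} {V : I -> lmodType R}.
Variable f : forall i, {linear Z -> V i}.

Definition dirsum_map (z : Z) : dirsum V := fun i => f i z.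

Fact dirsum_map_linear : linear dirsum_map.
Proof. by move=> c x y; apply/functional_extensionality_dep => i; apply: linearP. Qed.
HB.instance Definition _ :=
  GRing.isLinear.Build R Z (dirsum V) _ dirsum_map dirsum_map_linear.

End DirsumMap.

Section Inclusion.
Context {R : pzRingType} {M : lmodType R} (S T : submodule M) (ST : {subset S <= T}).

Definition incl (x : subm S) : subm T :=
  exist (fun x => x \in smem T) (val x) (ST (valP x)).

Fact incl_linear : linear incl.
Proof. by move=> c x y; apply: val_inj. Qed.
HB.instance Definition _ := GRing.isLinear.Build R (subm S) (subm T) _ incl incl_linear.

End Inclusion.

Lemma val_submB (R : pzRingType) (M : lmodType R) (S : submodule M) (x y : subm S) :
  val (x - y) = val x - val y.
Proof. exact: raddfB. Qed.

(** * Vector spaces: complements, sections and isomorphisms *)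

Section LinearAlgebra.
Context {K : fieldType}.
Implicit Types V W Z U : lmodType K.

Definition disjoint_from V (S : submodule V) (C : pred V) : Prop :=
  submod_closed (C : {pred V}) /\ forall x, x \in S -> C x -> x = 0.

(** Zorn's lemma: by maximality of C among the subspaces that meet S in zero,
    adding to C any vector outside S + C would meet S, which is absurd. *)
Lemma complement V (S : submodule V) : exists C : submodule V,
  (forall x, x \in S -> x \in C -> x = 0) /\
  (forall v, exists2 c, c \in C & v - c \in S).
Proof.
pose T := {C : pred V | `[< disjoint_from S C >]}.
pose le (C D : T) := `[< forall x, val C x -> val D x >].
have dis (C : T) : disjoint_from S (val C) by apply/asboolP/(valP C).
have [||||C Cmax] := @classical_sets.Zorn T le.
- by move=> C; apply/asboolP.
- by move=> C D E /asboolP CD /asboolP DE; apply/asboolP => x /CD/DE.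
- move=> C D /asboolP CD /asboolP DC; apply/val_inj/funext => x.
  by apply/idP/idP => [/CD|/DC].
- move=> A Atot; pose U : pred V := fun x => `[< x = 0 \/ exists2 C, A C & val C x >].
  have Ud : disjoint_from S U.
    split; last by move=> x xS /asboolP[//|[C _]]; have [_ dC] := dis C; apply: dC.
    split=> [|c x y /asboolP xU /asboolP yU]; apply/asboolP; first by left.
    have cl C : A C -> val C x -> val C y -> exists2 C, A C & val C (c *: x + y).
      by move=> AC Cx Cy; exists C => //; have [[_ CC] _] := dis C; apply: CC.
    case: xU => [->|[C AC Cx]].
      rewrite scaler0 add0r; case: yU => [->|[D AD Dy]]; [by left|by right; exists D].
    right; case: yU => [->|[D AD Dy]].
      by exists C => //; have [[C0 CC] _] := dis C; apply: CC.
    case: (Atot C D AC AD) => /asboolP CD; first by apply: cl AD (CD x Cx) Dy.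
    by apply: cl AC Cx (CD y Dy).
  exists (exist _ U (asboolT Ud)) => C AC; apply/asboolP => x Cx.
  by apply/asboolP; right; exists C.
have [Ccl Cd] := dis C; exists (Submodule Ccl); split=> // v.
have [vC|nvC] := pselect (exists2 c, val C c & v - c \in S); first exact: vC.
(* D is the sum of C and the line through v. *)
pose D : pred V := fun x => `[< exists k, val C (x - k *: v) >].
have Dcl : submod_closed (D : {pred V}).
  split=> [|c x y /asboolP[k xk] /asboolP[l yl]]; apply/asboolP.
    by exists 0; rewrite scale0r subr0; apply: Ccl.1.
  exists (c * k + l); have := Ccl.2 c _ _ xk yl.
  by rewrite scalerBr scalerA addrACA -opprD -scalerDl.
have Dd : disjoint_from S D.
  split=> // x xS /asboolP[k Cx]; have [k0|k0] := eqVneq k 0.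
    by apply: Cd => //; move: Cx; rewrite k0 scale0r subr0.
  case: nvC; exists ((- k^-1) *: (x - k *: v)).
    by have := Ccl.2 (- k^-1) _ _ Cx Ccl.1; rewrite addr0.
  rewrite scalerBr scaleNr [in X in _ - X]scaleNr opprD !opprK scalerA.
  by rewrite mulVf // scale1r addrCA subrr addr0; apply: rpredZ.
have CD : C = exist _ D (asboolT Dd).
  apply/esym/Cmax/asboolP => x Cx; apply/asboolP; exists 0.
  by rewrite scale0r subr0.
exists v; last by rewrite subrr; apply: rpred0.
have Dv : D v by apply/asboolP; exists 1; rewrite scale1r subrr; apply: Ccl.1.
by change (val C v); rewrite CD.
Qed.

Lemma linear_section V W (q : {linear V -> W}) : (forall w, exists v, q v = w) ->
  exists f : {linear W -> V}, forall w, q (f w) = w.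
Proof.
move=> qsurj.
have kcl : submod_closed ((fun v => q v == 0) : {pred V}).
  split=> [|c x y /eqP x0 /eqP y0]; rewrite unfold_in ?linear0 //.
  by rewrite linearP x0 y0 scaler0 addr0.
have [C [Cd Cs]] := complement (Submodule kcl).
have /choice[f fP] w : exists c, c \in C /\ q c = w.
  have [v <-] := qsurj w; have [c cC /eqP] := Cs v.
  by rewrite linearB => /eqP; rewrite subr_eq0 => /eqP qv; exists c.
have fl : linear f.
  move=> c x y; apply/eqP; rewrite -subr_eq0; apply/eqP/Cd.
    apply/eqP; rewrite -[LHS]/(q (f (c *: x + y) - (c *: f x + f y))).
    by rewrite linearB linearP (fP _).2 (fP x).2 (fP y).2 subrr.
  have [xC _] := fP x; have [yC _] := fP y; have [cC _] := fP (c *: x + y).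
  by rewrite rpredB // rpredD // rpredZ.
pose g : {linear W -> V} := HB.pack f (GRing.isLinear.Build K W V _ f fl).
by exists g => w; have [] := fP w.
Qed.

Lemma isomorphic_inv V W (g : {linear W -> V}) :
  (forall w, g w = 0 -> w = 0) -> (forall v, exists w, g w = v) -> isomorphic V W.
Proof.
move=> ginj gsurj; have [f fK] := linear_section gsurj.
exists f; exists g => // w; apply/eqP; rewrite -subr_eq0; apply/eqP/ginj.
by rewrite linearB fK subrr.
Qed.

(** Comparing two quotients of one space of cycles avoids building maps out of
    quotients. *)
Lemma isomorphic_same_kernel Z V W (p : {linear Z -> V}) (q : {linear Z -> W}) :
  (forall v, exists z, p z = v) -> (forall w, exists z, q z = w) ->
  (forall z, p z = 0 <-> q z = 0) -> isomorphic V W.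
Proof.
move=> psurj qsurj pq; have [f fK] := linear_section qsurj.
apply: (@isomorphic_inv _ _ (p \o f : {linear W -> V})) => [w /pq|v]; first by rewrite fK.
have [z <-] := psurj v; exists (q z); apply/eqP; rewrite -subr_eq0 -[X in X - _]/(p (f (q z))) -linearB.
by apply/eqP/pq; rewrite linearB fK subrr.
Qed.

(** The exact sequence 0 -> U -> V -> W -> 0, given through cycles: Z presents
    V and maps onto W, Z' presents U, and j lifts the map from U to V. The
    isomorphism is (w, u) |-> p (f w + j (h u)) for sections f of q and h of
    p'. *)
Lemma isomorphic_extension Z (Z' : lmodType K) V W U (p : {linear Z -> V}) (q : {linear Z -> W})
    (p' : {linear Z' -> U}) (j : {linear Z' -> Z}) :
  (forall v, exists z, p z = v) -> (forall w, exists z, q z = w) ->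
  (forall u, exists z, p' z = u) ->
  (forall z, p z = 0 -> q z = 0) -> (forall z, q (j z) = 0) ->
  (forall z, q z = 0 -> exists z', p (z - j z') = 0) ->
  (forall z, p' z = 0 <-> p (j z) = 0) ->
  isomorphic V (W * U)%type.
Proof.
move=> psurj qsurj p'surj pq qj qp pj.
have [f fK] := linear_section qsurj; have [h hK] := linear_section p'surj.
pose g0 (x : W * U) : V := p (f x.1 + j (h x.2)).
have gl : linear g0.
  move=> c [x u] [y v]; rewrite /g0 /= !linearP -[RHS]linearP; congr (p _).
  by rewrite scalerDr addrACA.
pose g : {linear (W * U)%type -> V} := HB.pack g0 (GRing.isLinear.Build K _ V _ g0 gl).
apply: (@isomorphic_inv _ _ g) => [[w u] gwu|v].
  have w0 : w = 0 by have := pq _ gwu; rewrite linearD /= fK qj addr0.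
  move: gwu; rewrite w0 /g /= /g0 /= linear0 add0r => /pj.
  by rewrite hK => ->.
have [z <-] := psurj v.
have [|z' zz'] := qp (z - f (q z)); first by rewrite linearB fK subrr.
exists (q z, p' z'); rewrite -[LHS]/(p (f (q z) + j (h (p' z')))) linearD.
have -> : p (j (h (p' z'))) = p (j z').
  apply/eqP; rewrite -subr_eq0 -(raddfB p) -(raddfB j).
  by apply/eqP/pj; rewrite linearB hK subrr.
by apply/eqP; rewrite eq_sym -subr_eq0 opprD addrA -!(raddfB p); apply/eqP; exact: zz'.
Qed.

Lemma isomorphic0 V : (forall v : V, v = 0) -> isomorphic V 'rV[K]_0.
Proof.
move=> V0; apply: (@isomorphic_inv _ _ (\0%R : {linear 'rV[K]_0 -> V})) => [w _|v].
  exact: thinmx0.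
by exists 0; rewrite (V0 v); apply: V0.
Qed.

End LinearAlgebra.

(** Exactness of a complex of vector spaces in matrix form. Unlike exactness
    for row vectors, the resulting identity between matrices over K can be
    applied to vectors with entries in any K-module. *)
Lemma kernel_split (K : fieldType) (n p m : nat) (A : 'M[K]_(n, p)) (B : 'M[K]_(m, n))
    (E : 'M[K]_n) :
  (forall u : 'rV_n, u *m A = 0 -> (u *m E <= B)%MS) ->
  exists C C', E = C *m B + A *m C'.
Proof.
move=> exA; pose U := 1%:M - A *m pinvmx A.
have /submxP[C UE] : (U *m E <= B)%MS.
  apply/row_subP => i; rewrite row_mul; apply: exA.
  by rewrite -row_mul mulmxBl mul1mx mulmxKpV // subrr row0.
exists C, (pinvmx A *m E).
by rewrite -UE mulmxBl mul1mx mulmxA subrK.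
Qed.

(** * Homogeneous polynomials *)

Section Polynomials.
Context {K : fieldType} {N : nat}.
Local Notation Q := {mpoly K[N]}.
Implicit Types (p q : Q) (m : 'X_{1..N}) (P : pred 'X_{1..N}).

Definition trunc P q : Q := \sum_(m <- msupp q | P m) q@_m *: 'X_[m].

(** Here m0 is the only exponent that E can send to m. *)
Lemma mcoeff_sum_supp q P (E : 'X_{1..N} -> 'X_{1..N}) m0 m :
  (forall m1, P m1 -> (E m1 == m) = (m1 == m0)) ->
  (\sum_(m1 <- msupp q | P m1) q@_m1 *: 'X_[E m1])@_m =
  if P m0 then q@_m0 else 0.
Proof.
move=> Em.
rewrite raddf_sum /= (eq_bigr (fun m1 => if m1 == m0 then q@_m0 else 0)); last first.
  move=> m1 Pm1; rewrite mcoeffZ mcoeffX Em //.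
  by case: eqP => [->|_]; rewrite ?mulr1 ?mulr0.
rewrite -big_mkcondr /=; case: ifP => Pm0; last first.
  by rewrite big_pred0 // => m1; case: eqP => [->|_]; rewrite ?Pm0 ?andbF.
rewrite (eq_bigl (pred1 m0)); last first.
  by move=> m1 /=; case: eqP => [->|_]; rewrite ?Pm0 ?andbF.
have [m0q|m0q] := boolP (m0 \in msupp q).
  by rewrite -big_filter filter_pred1_uniq ?msupp_uniq // big_seq1.
rewrite big_seq_cond big_pred0 ?memN_msupp_eq0 // => m1 /=.
by case: eqP => [->|_]; rewrite ?(negbTE m0q) ?andbF.
Qed.

Lemma mcoeff_trunc P q m : (trunc P q)@_m = if P m then q@_m else 0.
Proof. exact: (@mcoeff_sum_supp q P id). Qed.

Lemma mcoeffM_neq0 p q m : (p * q)@_m != 0 ->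
  exists m1 m2, [/\ m = (m1 + m2)%MM, p@_m1 != 0 & q@_m2 != 0].
Proof.
rewrite -mcoeff_msupp => /msuppM_le /allpairsP[[m1 m2] /= [m1p m2q ->]].
by exists m1, m2; rewrite -!mcoeff_msupp.
Qed.

(** Reading homogeneity on coefficients makes negative degrees harmless: only
    zero has them. *)
Definition hom (d : int) q : Prop := forall m, q@_m != 0 -> (mdeg m)%:Z = d.

Lemma homP (d : int) q : reflect (hom d q) ((q : restr (Q^o)) \in gdeg gring d).
Proof.
rewrite unfold_in /= /gring_deg; case: d => d.
  apply: (iffP (dhomogP mdeg d q)) => qd m; first by rewrite -mcoeff_msupp => /qd->.
  by rewrite mcoeff_msupp => /qd[].
apply: (iffP eqP) => [-> m|qd]; first by rewrite mcoeff0 eqxx.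
by apply/mpolyP => m; rewrite mcoeff0; apply: contra_eq (isT) => /qd.
Qed.

Lemma hom0 d : hom d 0. Proof. by move=> m; rewrite mcoeff0 eqxx. Qed.

Lemma homD d p q : hom d p -> hom d q -> hom d (p + q).
Proof.
move=> pd qd m; rewrite mcoeffD.
have [p0|/pd//] := eqVneq (p@_m) 0; have [q0|/qd//] := eqVneq (q@_m) 0.
by rewrite p0 q0 addr0 eqxx.
Qed.

Lemma homN d p : hom d p -> hom d (- p).
Proof. by move=> pd m; rewrite mcoeffN oppr_eq0 => /pd. Qed.

Lemma homB d p q : hom d p -> hom d q -> hom d (p - q).
Proof. by move=> pd /homN; apply: homD. Qed.

Lemma hom_sum d (I : Type) (r : seq I) (P : pred I) (G : I -> Q) :
  (forall i, P i -> hom d (G i)) -> hom d (\sum_(i <- r | P i) G i).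
Proof.
by move=> Gd; elim/big_ind: _ => //; [exact: hom0|move=> *; apply: homD].
Qed.

Lemma homZ d c p : hom d p -> hom d (c *: p).
Proof. by move=> pd m; rewrite mcoeffZ mulf_eq0 => /norP[_ /pd]. Qed.

Lemma homM d e p q : hom d p -> hom e q -> hom (d + e) (p * q).
Proof.
by move=> pd qe m /mcoeffM_neq0[m1 [m2 [-> /pd<- /qe<-]]]; rewrite mdegD PoszD.
Qed.

Lemma homC c : hom 0 c%:MP.
Proof.
move=> m; rewrite mcoeffC.
by have [->|_] := eqVneq m 0%MM; rewrite ?mdeg0 // mulr0 eqxx.
Qed.

Lemma homX m : hom (mdeg m) 'X_[m].
Proof. by move=> m'; rewrite mcoeffX; have [->|_] := eqVneq m m'; rewrite ?eqxx. Qed.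

Lemma hom_neq0 d q : hom d q -> d != 0 -> q@_0 = 0.
Proof. by move=> qd; apply: contra_neq_eq => /qd <-; rewrite mdeg0. Qed.

Lemma hom_const q : hom 0 q -> q = (q@_0)%:MP.
Proof.
move=> q0; apply/mpolyP => m; rewrite mcoeffC eq_sym.
have [->|m0] := eqVneq 0%MM m; first by rewrite mulr1.
rewrite mulr0; apply: contraNeq m0 => /q0/eqP.
by rewrite eqz_nat mdeg_eq0 eq_sym.
Qed.

Definition hcomp (d : int) q : Q := trunc (fun m => (mdeg m)%:Z == d) q.

Lemma mcoeff_hcomp d q m : (hcomp d q)@_m = if (mdeg m)%:Z == d then q@_m else 0.
Proof. exact: mcoeff_trunc. Qed.

Lemma hcomp_hom d q : hom d (hcomp d q).
Proof. by move=> m; rewrite mcoeff_hcomp; case: ifP => [/eqP|]; rewrite ?eqxx. Qed.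

Lemma hcomp_id d q : hom d q -> hcomp d q = q.
Proof.
move=> qd; apply/mpolyP=> m; rewrite mcoeff_hcomp; case: ifP => // /eqP md.
by apply/esym/(contra_not_eq _ md) => /qd.
Qed.

Lemma hcomp_is_linear d : linear (hcomp d).
Proof.
move=> c p q; apply/mpolyP=> m; rewrite !(mcoeffD, mcoeffZ, mcoeff_hcomp).
by case: ifP => // _; rewrite mulr0 addr0.
Qed.
HB.instance Definition _ d := GRing.isLinear.Build K Q Q _ (hcomp d) (hcomp_is_linear d).

Lemma hcomp0 d e q : hom e q -> d != e -> hcomp d q = 0.
Proof.
move=> qe de; apply/mpolyP=> m; rewrite mcoeff_hcomp mcoeff0; case: ifP => // /eqP md.
by apply: contraNeq de => /qe <-; rewrite md.
Qed.

Lemma hcompMl d e p q : hom d p -> hcomp e (p * q) = p * hcomp (e - d) q.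
Proof.
move=> pd; rewrite [q in LHS]mpolyE [q in RHS]mpolyE mulr_sumr !raddf_sum mulr_sumr /=.
apply: eq_bigr => m _; set x := _ *: _.
have xm : hom (mdeg m)%:Z x.
  by apply: homZ; apply: homX.
have [em|em] := eqVneq (e - d) (mdeg m)%:Z.
  rewrite em (hcomp_id xm) hcomp_id //.
  by have := homM pd xm; rewrite -em addrC subrK.
rewrite (hcomp0 xm em) mulr0 (hcomp0 (homM pd xm)) //.
by apply: contra em => /eqP ->; rewrite addrC addKr.
Qed.

Lemma hcomp_sum q : exists k, q = \sum_(d < k) hcomp d%:Z q.
Proof.
exists (msize q); apply/mpolyP => m; rewrite raddf_sum /=.
have [mq|mq] := ltnP (mdeg m) (msize q); last first.
  have q0 : q@_m = 0 by apply: contraTeq mq; rewrite -mcoeff_msupp -ltnNge => /msize_mdeg_lt.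
  by rewrite q0 big1 // => d _; rewrite mcoeff_hcomp q0 if_same.
rewrite (bigD1 (Ordinal mq)) //= mcoeff_hcomp eqxx big1 ?addr0 // => d.
by rewrite mcoeff_hcomp eqz_nat -val_eqE /= eq_sym => /negbTE ->.
Qed.

End Polynomials.

Lemma hom_lt0 (K : fieldType) (N : nat) d (q : {mpoly K[N]}) : hom d q -> d < 0 -> q = 0.
Proof.
move=> qd d0; apply/mpolyP => m; rewrite mcoeff0; apply: contraTeq d0 => /qd <-.
by rewrite -leNgt.
Qed.

Lemma hom_prod (K : fieldType) (N : nat) (I : Type) (r : seq I) (d : I -> int)
    (q : I -> {mpoly K[N]}) :
  (forall i, hom (d i) (q i)) -> hom (\sum_(i <- r) d i) (\prod_(i <- r) q i).
Proof.
move=> qd; elim: r => [|i r IH]; last by rewrite !big_cons; apply: homM.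
by rewrite !big_nil -mpolyC1; apply: homC.
Qed.

Lemma hom_exp (K : fieldType) (N : nat) (d : int) (q : {mpoly K[N]}) e :
  hom d q -> hom (d *+ e) (q ^+ e).
Proof.
move=> qd; elim: e => [|e IH]; first by rewrite mulr0n expr0 -mpolyC1; apply: homC.
by rewrite mulrS exprS; apply: homM.
Qed.

(** * Monomial ideals *)

Section MonomialIdeals.
Context {K : fieldType} {N : nat}.
Local Notation Q := {mpoly K[N]}.
Implicit Types (p q : Q) (m : 'X_{1..N}) (P : pred 'X_{1..N}).

Definition downclosed P := forall m1 m2, P (m1 + m2)%MM -> P m2.

(** Over a field these are exactly the monomial ideals, P being the set of
    exponents of the monomials outside the ideal. *)
Definition omit_pred P : {pred Q^o} := fun q => `[< forall m, P m -> (q : Q)@_m = 0 >].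

Fact omit_closed P : downclosed P -> submod_closed (omit_pred P).
Proof.
move=> dP; split=> [|c x y /asboolP x0 /asboolP y0]; apply/asboolP => m Pm.
  exact: mcoeff0.
rewrite [c *: x]/(c * x : Q) mcoeffD y0 // addr0; apply/eqP/negPn/negP.
by move/mcoeffM_neq0 => [m1 [m2 [mE _ /eqP]]]; rewrite mE in Pm; case; apply/x0/(dP m1).
Qed.

Definition omit_ideal P (dP : downclosed P) : submodule Q^o := Submodule (omit_closed dP).

Lemma omit_idealP P (dP : downclosed P) q :
  reflect (forall m, P m -> q@_m = 0) ((q : Q^o) \in omit_ideal dP).
Proof. exact: asboolP. Qed.

Definition avoids (S : pred 'I_N) : pred 'X_{1..N} := fun m => [forall (k | S k), m k == 0%N].

Lemma avoids_down S : downclosed (avoids S).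
Proof.
move=> m1 m2 /forall_inP m0; apply/forall_inP => k /m0.
by rewrite mnmDE addn_eq0 => /andP[].
Qed.

(** The ideal generated by the variables in S ([mulX_var_ideal] and
    [var_ideal_min]), in a form where membership is read on coefficients. *)
Definition var_ideal S : submodule Q^o := omit_ideal (@avoids_down S).

Lemma var_idealP S q : reflect (forall m, avoids S m -> q@_m = 0) ((q : Q^o) \in var_ideal S).
Proof. exact: omit_idealP. Qed.

Lemma var_ideal_sub (S T : pred 'I_N) : subpred S T -> {subset var_ideal S <= var_ideal T}.
Proof.
move=> ST q /var_idealP q0; apply/var_idealP => m /forall_inP mT; apply: q0.
by apply/forall_inP => k /ST/mT.
Qed.

Lemma var_ideal_none q : (q : Q^o) \in var_ideal pred0 -> q = 0.
Proof.
move=> /var_idealP q0; apply/mpolyP => m; rewrite mcoeff0 q0 //.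
exact/forall_inP.
Qed.

Lemma avoids_all m : avoids predT m = (m == 0%MM).
Proof.
apply/forall_inP/eqP => [m0|-> k _]; last by rewrite mnm0E.
by apply/mnmP => k; rewrite mnm0E; apply/eqP/m0.
Qed.

Lemma var_ideal_allP q : reflect (q@_0 = 0) ((q : Q^o) \in var_ideal predT).
Proof.
by apply: (iffP (var_idealP _ _)) => [->|q0 m] //; rewrite avoids_all // => /eqP->.
Qed.

Lemma mcoeffXM_neq0 k q m : ('X_k * q)@_m != 0 -> m k != 0%N.
Proof.
move=> /mcoeffM_neq0[m1 [m2 [-> ]]]; rewrite mcoeffX; case: (U_(k)%MM =P m1) => [<- _ _|_].
  by rewrite mnmDE mnm1E eqxx.
by rewrite eqxx.
Qed.

Lemma mnm_subK k m : m k != 0%N -> (U_(k) + (m - U_(k)) = m)%MM.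
Proof. by move=> mk; rewrite addmC submK // lep1mP. Qed.

(** The cofactor w collects the monomials divisible by 'X_k; the others form
    the remainder. *)
Lemma var_ideal_step (S : pred 'I_N) k d q : hom d q -> (q : Q^o) \in var_ideal (predU1 k S) ->
  exists2 w, hom (d - 1) w & (q - 'X_k * w : Q^o) \in var_ideal S.
Proof.
move=> qd /var_idealP q0.
pose w : Q := \sum_(m <- msupp q | m k != 0%N) q@_m *: 'X_[m - U_(k)].
have wE m : w@_m = q@_(U_(k) + m).
  rewrite (@mcoeff_sum_supp _ _ _ _ (fun m => m - U_(k))%MM (U_(k) + m)%MM).
    by rewrite mnmDE mnm1E eqxx.
  move=> m1 /mnm_subK m1k; rewrite -{2}m1k.
  by rewrite -(inj_eq (can_inj (addmK U_(k)))) ![(_ + U_(k))%MM]addmC.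
exists w => [m|].
  by rewrite wE => /qd <-; rewrite mdegD mdeg1 PoszD addrAC subrr add0r.
apply/var_idealP => m /forall_inP mS; rewrite mcoeffB.
have [mk|mk] := eqVneq (m k) 0%N.
  rewrite q0 ?sub0r; last first.
    by apply/forall_inP => k' /predU1P[->|/mS//]; apply/eqP.
  by apply/eqP; rewrite oppr_eq0; apply: contraTT isT => /mcoeffXM_neq0; rewrite mk.
by rewrite -{2}(mnm_subK mk) mulrC mcoeffMX wE mnm_subK // subrr.
Qed.

(** A variable outside S is a nonzerodivisor modulo the ideal of S. *)
Lemma var_ideal_mulX (S : pred 'I_N) k q : ~~ S k ->
  ('X_k * q : Q^o) \in var_ideal S -> (q : Q^o) \in var_ideal S.
Proof.
move=> nSk /var_idealP q0; apply/var_idealP => m /forall_inP mS.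
rewrite -(@mcoeffMX _ _ q U_(k) m) mulrC q0 //; apply/forall_inP => k' Sk'.
rewrite mnmDE mnm1E; case: (k =P k') => [kk'|_]; last exact: mS.
by rewrite kk' Sk' in nSk.
Qed.

Lemma mulX_var_ideal (S : pred 'I_N) k q : S k -> ('X_k * q : Q^o) \in var_ideal S.
Proof.
move=> Sk; apply/var_idealP => m /forall_inP mS; apply/eqP.
by apply: contraTT (mS k Sk) => /mcoeffXM_neq0.
Qed.

Lemma mem_ideal_mnm (J : submodule Q^o) q :
  (forall m, q@_m != 0 -> ('X_[m] : Q^o) \in J) -> (q : Q^o) \in J.
Proof.
move=> qJ; rewrite [q]mpolyE big_seq; apply: rpred_sum => m.
by rewrite mcoeff_msupp => /qJ mJ; rewrite -mul_mpolyC; apply: idealM.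
Qed.

Lemma mem_ideal_mnmX (J : submodule Q^o) k m :
  m k != 0%N -> ('X_k : Q^o) \in J -> ('X_[m] : Q^o) \in J.
Proof. by move=> /mnm_subK<- kJ; rewrite addmC mpolyXD; apply: idealM. Qed.

Lemma var_ideal_min (S : pred 'I_N) (J : submodule Q^o) :
  (forall k, S k -> ('X_k : Q^o) \in J) -> {subset var_ideal S <= J}.
Proof.
move=> SJ q /var_idealP q0; apply: mem_ideal_mnm => m qm.
have /forall_inPn[k Sk mk] : ~~ avoids S m by apply: contra qm => /q0 ->.
exact: mem_ideal_mnmX mk (SJ k Sk).
Qed.

Lemma irrelevant_var_ideal : (irrelevant : submodule Q^o) =i var_ideal predT.
Proof.
move=> q; apply/idP/idP; last by apply: var_ideal_min => k _; apply: mem_span; exists k.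
move: q; apply: span_sub => _ [j ->]; rewrite -[X in X \in _]mulr1.
exact: mulX_var_ideal.
Qed.

End MonomialIdeals.

Lemma idealZ (K : fieldType) (N : nat) (J : submodule {mpoly K[N]}^o) (c : K)
    (q : {mpoly K[N]}) :
  (q : {mpoly K[N]}^o) \in J -> (c *: q : {mpoly K[N]}^o) \in J.
Proof. by rewrite -mul_mpolyC; apply: idealM. Qed.

(** * Homogeneous ideals *)

Section Homogeneity.
Context {K : fieldType} {N : nat}.
Local Notation Q := {mpoly K[N]}.

Definition homogeneous (J : submodule Q^o) : Prop :=
  forall d (q : Q), (q : Q^o) \in J -> (hcomp d q : Q^o) \in J.

Lemma homogeneous_omit P (dP : downclosed P) : homogeneous (omit_ideal (K := K) dP).
Proof.
move=> d q /omit_idealP q0; apply/omit_idealP => m Pm; rewrite mcoeff_hcomp q0 //.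
exact: if_same.
Qed.

(** The polynomials with all components in the ideal form an ideal, since the
    components of a product are sums of products of components. *)
Lemma homogeneous_span (G : Q^o -> Prop) :
  (forall d (g : Q), G g -> (hcomp d g : Q^o) \in Defs.span G) -> homogeneous (Defs.span G).
Proof.
move=> GJ; pose P : {pred Q^o} := fun q => `[< forall d, (hcomp d (q : Q) : Q^o) \in Defs.span G >].
have PZ : submod_closed P.
  split=> [|c x y /asboolP xP /asboolP yP]; apply/asboolP => d.
    by rewrite raddf0 rpred0.
  have -> : hcomp d (c *: x + y : Q) = hcomp d ((c : Q) * (x : Q)) + hcomp d (y : Q).
    exact: raddfD.
  apply: rpredD; last exact: yP.
  have [k ->] := hcomp_sum (c : Q).
  rewrite mulr_suml raddf_sum; apply: rpred_sum => e _.
  rewrite /= (hcompMl _ _ (@hcomp_hom _ _ _ _)).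
  exact: (@idealM _ (Defs.span G) _ _ (xP _)).
move=> d q qG; move: d; apply/asboolP.
move: q qG; apply: (span_sub (S := Submodule PZ)) => g Gg; apply/asboolP => d.
exact: GJ.
Qed.

Definition inter (I : Type) (J : I -> submodule Q^o) : submodule Q^o.
Proof.
apply: (@Submodule _ _ (fun q => `[< forall i, q \in J i >])).
split=> [|c x y /asboolP xJ /asboolP yJ]; apply/asboolP => i; first exact: rpred0.
by apply: rpredD (yJ i); apply: idealM.
Defined.

Lemma interP (I : Type) (J : I -> submodule Q^o) (q : Q^o) :
  reflect (forall i, q \in J i) (q \in inter J).
Proof. exact: asboolP. Qed.

Lemma homogeneous_inter (I : Type) (J : I -> submodule Q^o) :
  (forall i, homogeneous (J i)) -> homogeneous (inter J).
Proof. by move=> hJ d q /interP qJ; apply/interP => i; apply: hJ. Qed.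

End Homogeneity.

(** * Cycles and boundaries modulo an ideal, degree by degree *)

Section Strands.
Context {K : fieldType} {N : nat}.
Local Notation Q := {mpoly K[N]}.
Variables (L : gmod (K := K) (N := N)) (F : gres L).

Notation QF := (tens (gring (K := K) (N := N)) F).

(** Vectors of degree s in Q (x) F_t: the generator of index j sits in degree
    dg j. *)
Definition homs (s : int) t (z : QF t) : Prop := forall j, hom (s - dg (g := F) j) (z j : Q).

Lemma tdifE t (z : QF t.+1) k : tdif z k = \sum_j (z j : Q) * dif F t j k.
Proof. by apply: eq_bigr => j _; rewrite mulrC. Qed.

Lemma tdif_mul t (z : QF t.+1) k : tdif z k = ((\row_j (z j : Q)) *m dif F t) 0 k.
Proof. by rewrite tdifE mxE; apply: eq_bigr => j _; rewrite mxE. Qed.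

Lemma hom_dif t j k : hom (dg (g := F) j - dg (g := F) k) (dif F t j k).
Proof. apply/homP; exact: dif_homog. Qed.

Lemma homs_tdif s t (z : QF t.+1) : homs s z -> homs s (tdif z).
Proof.
move=> zs k; rewrite tdifE; apply: hom_sum => j _.
by have := homM (zs j) (@hom_dif t j k); rewrite addrA subrK.
Qed.

Lemma homsD s t (z z' : QF t) : homs s z -> homs s z' -> homs s (z + z').
Proof. by move=> zs zs' j; apply: homD (zs j) (zs' j). Qed.

Lemma homsB s t (z z' : QF t) : homs s z -> homs s z' -> homs s (z - z').
Proof. by move=> zs zs' j; apply: homB (zs j) (zs' j). Qed.

Lemma homsM d s t q (z : QF t) : hom d q -> homs s z -> homs (d + s) (q *: z).
Proof. by move=> qd zs j; rewrite -addrA; apply: homM qd (zs j). Qed.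

Lemma tdif_tdif t (z : QF t.+2) : tdif (tdif z) = 0.
Proof.
apply/functional_extensionality_dep => k; rewrite tdif_mul.
have -> : \row_j (tdif z j : Q) = (\row_j (z j : Q)) *m dif F t.+1.
  by apply/rowP => j; rewrite mxE tdif_mul.
set u := \row_j _; rewrite (_ : _ *m _ = 0) ?mxE //.
by apply/dif_exact; exists u.
Qed.

Definition hcomps (s : int) t (z : QF t) : QF t := fun j => hcomp (s - dg (g := F) j) (z j : Q).

Lemma hcomps_homs s t (z : QF t) : homs s (hcomps s z).
Proof. by move=> j; apply: hcomp_hom. Qed.

(** As the differential has degree 0, taking components turns any preimage of
    a homogeneous boundary into a homogeneous one. *)
Lemma hcomps_tdif s t (z : QF t.+1) : tdif (hcomps s z) = hcomps s (tdif z).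
Proof.
apply/functional_extensionality_dep => k; rewrite /hcomps !tdifE raddf_sum /=.
apply: eq_bigr => j _; rewrite mulrC [in RHS]mulrC (hcompMl _ _ (@hom_dif t j k)).
by rewrite opprB addrA subrK mulrC.
Qed.

Lemma hcomps_id s t (z : QF t) : homs s z -> hcomps s z = z.
Proof.
by move=> zs; apply/functional_extensionality_dep => j; apply: hcomp_id.
Qed.

Lemma strand_exact s t (z : QF t.+1) : homs s z -> tdif z = 0 ->
  exists2 v : QF t.+2, homs s v & z = tdif v.
Proof.
move=> zs z0; have [|v vE] := (dif_exact (\row_j (z j : Q))).1.
  by apply/rowP => k; rewrite -tdif_mul z0 mxE.
exists (hcomps s (fun j => v 0 j : Q)); first exact: hcomps_homs.
rewrite hcomps_tdif -[LHS](hcomps_id zs); congr hcomps.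
apply/functional_extensionality_dep => k; rewrite tdif_mul.
have := congr1 (fun M : 'rV_(rk F t.+1) => M 0 k) vE.
rewrite mxE => ->; congr ((_ *m _) 0 k); by apply/rowP => j; rewrite mxE.
Qed.

Definition within (J : submodule Q^o) t (z : QF t) : Prop := forall k, (z k : Q^o) \in J.

(** Vectors over Q that become cycles of (Q/J) (x) F_t. *)
Definition cyc (J : submodule Q^o) t : QF t -> Prop :=
  match t return QF t -> Prop with
  | 0 => fun=> True
  | t'.+1 => fun z => within J (tdif z)
  end.

Lemma withinD J t (z z' : QF t) : within J z -> within J z' -> within J (z + z').
Proof. by move=> zJ zJ' k; apply: (rpredD (zJ k) (zJ' k)). Qed.

Lemma withinB J t (z z' : QF t) : within J z -> within J z' -> within J (z - z').
Proof. by move=> zJ zJ' k; apply: (rpredB (zJ k) (zJ' k)). Qed.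

Lemma within0 J t : within J (0 : QF t).
Proof. by move=> k; apply: rpred0. Qed.

Lemma withinN J t (z : QF t) : within J (- z) -> within J z.
Proof.
have {2}-> : z = 0 - (- z) by rewrite sub0r opprK.
by apply: withinB; apply: within0.
Qed.

Lemma within_tdif J t (z : QF t.+1) : within J z -> within J (tdif z).
Proof.
move=> zJ k; change ((\sum_j dif F t j k *: (z j : Q^o)) \in J).
apply: rpred_sum => j _.
exact: (idealM (dif F t j k) (zJ j)).
Qed.

Lemma sub_within (J J' : submodule Q^o) t (z : QF t) :
  {subset J <= J'} -> within J z -> within J' z.
Proof. by move=> JJ' zJ k; apply/JJ'/zJ. Qed.

Lemma cyc_within J t (z : QF t) : within J z -> cyc J z.
Proof. by case: t z => // t z; apply: within_tdif. Qed.

Lemma cyc_tdif J t (z : QF t.+1) : cyc J (tdif z).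
Proof. by case: t z => // t z k; rewrite tdif_tdif; apply: rpred0. Qed.

Lemma cycD J t (z z' : QF t) : cyc J z -> cyc J z' -> cyc J (z + z').
Proof. by case: t z z' => // t z z' zJ zJ'; rewrite /= raddfD; apply: withinD. Qed.

Lemma cycB J t (z z' : QF t) : cyc J z -> cyc J z' -> cyc J (z - z').
Proof. by case: t z z' => // t z z' zJ zJ'; rewrite /= raddfB; apply: withinB. Qed.

(** Vectors over Q that become boundaries of (Q/J) (x) F; the witness v is
    required to be homogeneous, so that all estimates on degrees apply to it. *)
Definition bnd (J : submodule Q^o) (s : int) t (z : QF t) : Prop :=
  exists2 v : QF t.+1, homs s v & within J (z - tdif v).

Lemma cyc_sub (J J' : submodule Q^o) t (z : QF t) :
  {subset J <= J'} -> cyc J z -> cyc J' z.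
Proof. by case: t z => // t z; apply: sub_within. Qed.

Lemma within_trans (J : submodule Q^o) t (x y z : QF t) :
  within J (x - y) -> within J (y - z) -> within J (x - z).
Proof. by move=> xy yz; rewrite -[x](subrK y) -addrA; apply: withinD. Qed.

Lemma within_sym (J : submodule Q^o) t (x y : QF t) :
  within J (x - y) -> within J (y - x).
Proof. by move=> xy; apply: withinN; rewrite opprB. Qed.

Lemma bnd_sub (J J' : submodule Q^o) s t (z : QF t) : {subset J <= J'} -> bnd J s z -> bnd J' s z.
Proof. by move=> JJ [v vs vJ]; exists v => //; apply: sub_within vJ. Qed.

Lemma within_bnd (J : submodule Q^o) s t (z : QF t) : within J z -> bnd J s z.
Proof. by move=> zJ; exists 0; [move=> k; apply: hom0|rewrite raddf0 subr0]. Qed.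

End Strands.

(** * The Koszul property of the polynomial ring *)

Section Koszul.
Context {K : fieldType} {N : nat}.
Local Notation Q := {mpoly K[N]}.
Variable F : gres (gquot gring (irrelevant : submodule Q^o)).
Notation QF := (tens (gring (K := K) (N := N)) F).

(** In position 0 the homology of F is K, which lives in degree 0 only. *)
Lemma strand_exact0 s (z : QF 0) : s != 0 -> homs s z ->
  exists2 v : QF 1, homs s v & z = tdif v.
Proof.
move=> s0 zs; have [|v vE] := (aug_exact (g := F) (\row_j (z j : Q))).1.
  rewrite [X in aug F X](row_sum_delta _) raddf_sum /= big1 // => j _.
  rewrite linearZ /= mxE.
  have /asboolP[p /homP pj ->] := aug_homog (g := F) j.
  rewrite [_ *: _]pi_qscale; apply/quot_eq0; rewrite irrelevant_var_ideal.
  apply/var_ideal_allP; have := homM (zs j) pj; rewrite subrK => /hom_neq0; exact.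
exists (hcomps s (fun j => v 0 j : Q)); first exact: hcomps_homs.
rewrite hcomps_tdif -[LHS](hcomps_id zs); congr hcomps.
apply/functional_extensionality_dep => k; rewrite tdif_mul.
have := congr1 (fun M : 'rV_(rk F 0) => M 0 k) vE.
rewrite mxE => ->; congr ((_ *m _) 0 k); by apply/rowP => j; rewrite mxE.
Qed.

(** With J the ideal of S and x = 'X_k a nonzerodivisor modulo J, multiplication
    by x gives an exact sequence 0 -> (Q/J)(-1) -> Q/J -> Q/(J + xQ) -> 0. Hence
    Tor_t(Q/(J + xQ))_s lies between Tor_t(Q/J)_s and Tor_(t-1)(Q/J)_(s-1), both
    zero when s <> t. For S empty this is the exactness of F. *)
Lemma koszul (S : seq 'I_N) s t (z : QF t) : s != t%:Z -> homs s z ->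
  cyc (var_ideal (mem S)) z -> bnd (var_ideal (mem S)) s z.
Proof.
elim: S s t z => [|k S IH] s t z st zs zc.
  have none q : (q : Q^o) \in var_ideal (mem [::]) -> q = 0.
    by move/(@var_ideal_sub _ _ _ pred0 (fun _ => id)); apply: var_ideal_none.
  case: t z st zs zc => [|t] z st zs zc.
    have [v vs ->] := strand_exact0 st zs.
    by exists v => // k; rewrite subrr; apply: rpred0.
  have [|v vs ->] := strand_exact zs.
    by apply/functional_extensionality_dep => k; apply/none/zc.
  by exists v => // k; rewrite subrr; apply: rpred0.
have sub : {subset var_ideal (K := K) (mem S) <= var_ideal (mem (k :: S))}.
  by apply: var_ideal_sub => k' /= k'S; rewrite inE k'S orbT.
have [kS|kS] := boolP (k \in S).
  have sub' : {subset var_ideal (K := K) (mem (k :: S)) <= var_ideal (mem S)}.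
    by apply: var_ideal_sub => k' /=; rewrite inE => /predU1P[->|].
  have [|v vs vJ] := IH s t z st zs; last by exists v => //; apply: sub_within vJ.
  by case: t z {st zs} zc => // t z; apply: sub_within.
(* It is enough to reach a cycle modulo the ideal of S by adding to z a
   multiple of 'X_k. *)
have final (z2 : QF t) (v : QF t) : homs s z2 -> cyc (var_ideal (mem S)) z2 ->
    z = z2 + 'X_k *: v -> bnd (var_ideal (mem (k :: S))) s z.
  move=> z2s z2c zE; have [v' v's v'J] := IH _ _ _ st z2s z2c.
  exists v' => //; rewrite zE addrAC; apply: withinD.
    exact: sub_within v'J.
  by move=> j; apply: mulX_var_ideal; apply: mem_head.
case: t z st zs zc final => [|t] z st zs zc final.
  by apply: (final z 0) => //; rewrite scaler0 addr0.
(* The boundary of z is 'X_k W modulo the ideal of S; so W is itself a cycle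
   modulo that ideal, in position t and degree s - 1, hence a boundary. *)
have /choice[w wP] j : exists w : Q, hom (s - 1 - dg (g := F) j) w /\
     ((tdif z j : Q) - 'X_k * w : Q^o) \in var_ideal (mem S).
  have [] := @var_ideal_step _ _ (mem S) k (s - dg (g := F) j) (tdif z j : Q).
  - exact: homs_tdif.
  - by apply: var_ideal_sub (zc j) => k' /=; rewrite inE.
  by move=> w wh wv; exists w; rewrite addrAC.
pose W : QF t := w.
have Ws : homs (s - 1) W by move=> j; have [] := wP j.
have WJ : within (var_ideal (mem S)) (tdif z - 'X_k *: W) by move=> j; have [] := wP j.
have [|||v vs vJ] := IH (s - 1) t W.
- by apply: contra st => /eqP/(canRL (subrK _)) ->; rewrite -addn1 PoszD.
- exact: Ws.
- case: t z w W st {zs zc final wP Ws} WJ => // t z w W _ WJ j.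
  apply: (var_ideal_mulX (k := k)) => //; move: j; apply: withinN.
  by have := within_tdif WJ; rewrite raddfB /= tdif_tdif sub0r linearZ.
apply: (final (z - 'X_k *: v) v); last by rewrite subrK.
  apply: homsB => //; have := homsM (@homX K N U_(k)%MM) vs.
  by rewrite mdeg1 addrC subrK.
rewrite /= raddfB /= linearZ /=.
have -> : tdif z - 'X_k *: tdif v = (tdif z - 'X_k *: W) + 'X_k *: (W - tdif v).
  by rewrite scalerBr addrA subrK.
apply: withinD => // j.
by apply: idealM; apply: vJ.
Qed.

End Koszul.

(** * Vanishing of Tor in internal degrees where the module vanishes *)

Section Concentration.
Context {K : fieldType} {N : nat}.
Local Notation Q := {mpoly K[N]}.
Variable F : gres (gquot gring (irrelevant : submodule Q^o)).
Notation QF := (tens (gring (K := K) (N := N)) F).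
Implicit Types J : submodule Q^o.

Notation dgr j := (dg (g := F) j).

Lemma koszul_const e t (z : QF t) : e != t%:Z -> homs e z ->
  cyc (var_ideal predT) z -> bnd (var_ideal predT) e z.
Proof.
move=> et ze zc.
have E' : {subset var_ideal (K := K) (mem (enum 'I_N)) <= var_ideal predT} by apply: var_ideal_sub.
have [|v vs vJ] := @koszul K N F (enum 'I_N) e t z et ze.
- case: t z {et ze} zc => // t z; apply: sub_within.
  by apply: var_ideal_sub => k _ /=; rewrite mem_enum.
by exists v => //; apply: sub_within vJ.
Qed.

(** The differential of K (x) F. *)
Definition dif0 t : 'M[K]_(rk F t.+1, rk F t) := \matrix_(j, k) (dif F t j k)@_0.

Lemma dif_eq t j k : dgr j = dgr k -> dif F t j k = (dif0 t j k)%:MP.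
Proof.
move=> jk; rewrite mxE; apply: hom_const.
by have := @hom_dif _ _ _ F t j k; rewrite jk subrr.
Qed.

Lemma dif_lt t (j : 'I_(rk F t.+1)) k : dgr j < dgr k -> dif F t j k = 0.
Proof. by move=> jk; apply: hom_lt0 (@hom_dif _ _ _ F t j k) _; rewrite subr_lt0. Qed.

Lemma dif0_neq t (j : 'I_(rk F t.+1)) k : dgr j != dgr k -> dif0 t j k = 0.
Proof. by move=> jk; rewrite mxE (hom_neq0 (@hom_dif _ _ _ F t j k)) // subr_eq0. Qed.

(** The projection of F_t onto its generators of degree e. *)
Definition degmx e t : 'M[K]_(rk F t) := \matrix_(j, k) ((j == k) && (dgr j == e))%:R.

(** The strand of degree e of the differential of K (x) F: the entries of
    [dif0] between generators of different degrees vanish ([dif0_neq]). *)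
Definition dif0_at e t : 'M[K]_(rk F t.+1, rk F t) :=
  \matrix_(j, k) if dgr j == e then dif0 t j k else 0.

(** The Koszul property of K = Q/m, read on constant vectors. *)
Lemma const_exact e t (u : 'rV[K]_(rk F t)) : e != t%:Z ->
  match t return 'rV[K]_(rk F t) -> Prop with
  | 0 => fun=> True | t'.+1 => fun u => u *m dif0_at e t' = 0 end u ->
  (u *m degmx e t <= dif0_at e t)%MS.
Proof.
move=> et uc; pose z : QF t := fun j => (if dgr j == e then u 0 j else 0)%:MP : Q.
have zs : homs e z.
  move=> j; rewrite /z; case: eqP => [->|_]; first by rewrite subrr; apply: homC.
  by rewrite mpolyC0; apply: hom0.
have [|v vs vJ] := koszul_const et zs.
  case: t u et uc @z {zs} => // t u _ uc z l; apply/var_ideal_allP.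
  rewrite tdifE raddf_sum /=; have := congr1 (fun M : 'rV_(rk F t) => M 0 l) uc.
  rewrite !mxE => uE; rewrite -[RHS]uE; apply: eq_bigr => j _; rewrite /z !mxE mcoeffCM.
  by case: eqP => // _; rewrite mul0r mulr0.
apply/submxP; exists (\row_l (v l : Q)@_0); apply/rowP => k; rewrite !mxE.
rewrite (bigD1 k) //= mxE eqxx big1 ?addr0 => [|j jk]; last first.
  by rewrite mxE (negbTE jk) mulr0.
have /var_ideal_allP := vJ k; rewrite mcoeffB tdifE raddf_sum /= mcoeffC eqxx mulr1.
move=> /eqP; rewrite subr_eq0 /= => /eqP zE.
transitivity ((if dgr k == e then u 0 k else 0) : K).
  by case: eqP => _; rewrite ?mulr1 ?mulr0.
rewrite zE; apply: eq_bigr => l _; rewrite rmorphM !mxE /=.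
case: eqP => // /eqP le; rewrite (hom_neq0 (vs l)) ?mul0r //.
by rewrite subr_eq0 eq_sym.
Qed.

Lemma const_split e t : e != t%:Z ->
  exists C : 'M[K]_(rk F t, rk F t.+1),
    match t return 'M[K]_(rk F t, rk F t.+1) -> Prop with
    | 0 => fun C => degmx e 0 = C *m dif0_at e 0
    | t'.+1 => fun C => exists C',
        degmx e t'.+1 = C *m dif0_at e t'.+1 + dif0_at e t' *m C'
    end C.
Proof.
case: t => [|t] et.
  have [|C [C' ->]] := @kernel_split K _ 0 _ 0 (dif0_at e 0) (degmx e 0).
    by move=> u _; apply: const_exact.
  by exists C; rewrite mul0mx addr0.
have [|C [C' ->]] := @kernel_split K _ _ _ (dif0_at e t) (dif0_at e t.+1) (degmx e t.+1).
  by move=> u ?; apply: const_exact.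
by exists C, C'.
Qed.

(** If all components of y against generators of degree greater than e are
    zero modulo J0, then those in degree exactly e form, modulo J0, a cycle for
    the constant part of the differential alone: entries of the differential
    from lower to higher degree vanish. The splitting C of the constant strand writes them as
    a boundary, whose other nonzero components have degree less than e. *)
Lemma concentrated_step (J0 J : submodule Q^o) s e t (y : QF t) :
  e != t%:Z -> homs s y -> within J y -> cyc J0 y ->
  (forall j, e < dgr j -> (y j : Q^o) \in J0) ->
  exists w : QF t.+1, [/\ homs s w, within J w &
    forall j, e <= dgr j -> ((y j : Q) - tdif w j : Q^o) \in J0].
Proof.
move=> et ys yJ yc ye; have [C CE] := const_split et.
pose w : QF t.+1 := fun l => (if dgr l == e then
  \sum_(j | dgr j == e) C j l *: (y j : Q) else 0) : Q.
have wE k : dgr k = e -> tdif w k = \sum_(j | dgr j == e) (C *m dif0_at e t) j k *: (y j : Q).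
  move=> ke; rewrite tdifE; under [RHS]eq_bigr do rewrite mxE scaler_suml.
  rewrite exchange_big /=; apply: eq_bigr => l _; rewrite /w mxE.
  case: eqP => [le|_]; last first.
    by rewrite mul0r big1 // => j _; rewrite mulr0 scale0r.
  rewrite dif_eq ?le // mulrC mul_mpolyC scaler_sumr; apply: eq_bigr => j _.
  by rewrite scalerA mulrC.
exists w; split.
- move=> l; rewrite /w; case: eqP => [->|_]; last exact: hom0.
  by apply: hom_sum => j /eqP <-; apply: homZ; apply: ys.
- move=> l; rewrite /w; case: eqP => [_|_]; last exact: rpred0.
  by apply: rpred_sum => j _; apply: idealZ; apply: yJ.
move=> k; rewrite le_eqVlt => /predU1P[ke|ek]; last first.
  rewrite (_ : tdif w k = 0) ?subr0; first exact: ye.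
  rewrite tdifE big1 // => l _; rewrite /w; case: eqP => [le|_]; last by rewrite mul0r.
  by rewrite dif_lt ?mulr0 // le.
have yE : (y k : Q) = \sum_(j | dgr j == e) degmx e t j k *: (y j : Q).
  rewrite (bigD1 k) ?ke //= mxE !eqxx scale1r big1 ?addr0 // => j /andP[_ jk].
  by rewrite mxE (negbTE jk) scale0r.
rewrite wE // yE -sumrB.
case: t y C w wE k ke yE et ys yJ yc ye CE => [|t] y C w wE k ke yE et ys yJ yc ye CE.
  by rewrite big1 ?rpred0 // => j _; rewrite CE subrr.
case: CE => C' CE.
under eq_bigr => j _ do rewrite CE -scalerBl [X in (X - _) *: _]mxE addrAC subrr add0r mxE scaler_suml.
rewrite exchange_big /=; apply: rpred_sum => l _.
under eq_bigr do rewrite mulrC -scalerA.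
rewrite -scaler_sumr; apply: idealZ.
have [le|le] := eqVneq (dgr l) e; last first.
  rewrite big1 ?rpred0 // => j /eqP je.
  by rewrite mxE je eqxx dif0_neq ?scale0r // je eq_sym.
have := yc l; rewrite tdifE (bigID (fun j => dgr j == e)) /= => yl.
have : (\sum_(j | dgr j != e) (y j : Q) * dif F t j l : Q^o) \in J0.
  apply: rpred_sum => j je; have [ej|] := ltP e (dgr j).
    by rewrite mulrC; apply: (idealM (dif F t j l) (ye j ej)).
  rewrite le_eqVlt (negbTE je) /= => ej.
  by rewrite dif_lt ?mulr0 ?rpred0 // le.
move=> yl'; have := @rpredB _ (smem J0) _ _ yl yl'; rewrite addrK => yle.
rewrite (eq_bigr (fun j => (y j : Q) * dif F t j l)) // => j /eqP je.
apply/esym; by rewrite dif_eq ?je ?le // mulrC mul_mpolyC [in RHS]mxE je eqxx.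
Qed.

(** For J0 inside J this is [Tor_t(J/J0, K)]_s = 0 when (J/J0)_(s-t) = 0.
    Components of y are cleared from the highest degree e of a generator of F_t
    downwards; in degree e = t they are zero modulo J0 because they have degree
    s - t. *)
Lemma concentrated (J0 J : submodule Q^o) s t (y : QF t) :
  (forall q : Q, hom (s - t%:Z) q -> (q : Q^o) \in J -> (q : Q^o) \in J0) ->
  homs s y -> within J y -> cyc J0 y ->
  exists w : QF t.+1, [/\ homs s w, within J w & within J0 (y - tdif w)].
Proof.
move=> JJ0.
have step e (z : QF t) : homs s z -> within J z -> cyc J0 z ->
    (forall j, e < dgr j -> (z j : Q^o) \in J0) ->
    exists w : QF t.+1, [/\ homs s w, within J w &
      forall j, e <= dgr j -> ((z j : Q) - tdif w j : Q^o) \in J0].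
  have [->|et] := eqVneq e t%:Z; last exact: concentrated_step et.
  move=> zs zJ zc ze; exists 0; split=> [j||j]; [exact: hom0|exact: within0|].
  rewrite raddf0 subr0 le_eqVlt => /predU1P[je|/ze//].
  by apply: JJ0 (zJ j); rewrite je; apply: zs.
pose lo : int := - (\sum_(j < rk F t) `|dgr j|%N)%:Z.
pose hi : int := (\sum_(j < rk F t) `|dgr j|%N)%:Z.
have absle (j : 'I_(rk F t)) : (`|dgr j|%N)%:Z <= hi.
  by rewrite /hi lez_nat (bigD1 j) //= leq_addr.
have lob (j : 'I_(rk F t)) : lo <= dgr j.
  by rewrite /lo -/hi lerNl (le_trans _ (absle j)) // abszE -normrN ler_norm.
have hib (j : 'I_(rk F t)) : dgr j <= hi by rewrite (le_trans _ (absle j)) // abszE ler_norm.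
suff desc d e (z : QF t) : e < lo + d%:Z ->
    homs s z -> within J z -> cyc J0 z ->
    (forall j, e < dgr j -> (z j : Q^o) \in J0) ->
    exists w : QF t.+1, [/\ homs s w, within J w & within J0 (z - tdif w)].
  move=> ys yJ yc; apply: (desc (`|hi - lo|.+1)%N hi y) => // [|j].
    rewrite -addn1 PoszD gez0_abs; first by rewrite addrA [lo + _]addrC subrK ltzD1.
    by rewrite subr_ge0 /lo -/hi -subr_ge0 opprK addr_ge0.
  by rewrite ltNge hib.
elim: d e z => [|d IH] e z ed zs zJ zc ze.
  exists 0; split=> [j||j]; [exact: hom0|exact: within0|].
  rewrite raddf0 subr0; apply: ze; apply: lt_le_trans (lob j).
  by rewrite addr0 in ed.
have [w [ws wJ we]] := step e z zs zJ zc ze.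
have [||||j ej|w' [w's w'J w'0]] := IH (e - 1) (z - tdif w).
- by rewrite ltrBlDr -addrA; move: ed; rewrite -addn1 PoszD.
- by apply: homsB => //; apply: homs_tdif.
- by apply: withinB => //; apply: within_tdif.
- by apply: cycB => //; apply: cyc_tdif.
- by apply: we; rewrite -lezD1 subrK in ej.
exists (w + w'); split; [exact: homsD|exact: withinD|].
by rewrite raddfD opprD addrA.
Qed.

End Concentration.

(** * The ideals of the fiber product *)

Section Ideals.
Context (K : fieldType) {r : nat} (n : 'I_r -> nat).
Local Notation N := (\sum_i n i)%N.
Local Notation R i := {mpoly K[n i]}.
Local Notation Q := {mpoly K[N]}.

Definition grp (k : 'I_N) : 'I_r := tagnat.sig1 k.
Definition outside (i : 'I_r) : pred 'I_N := fun k => grp k != i.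
Definition others_ideal (i : 'I_r) : submodule Q^o := var_ideal (outside i).

Fact embed_pre_closed (i : 'I_r) (J : submodule Q^o) :
  submod_closed ((fun f => (embed f : Q^o) \in J) : {pred (R i)^o}).
Proof.
split=> [|c g h gP hP]; first by rewrite unfold_in /embed comp_mpoly0; apply: rpred0.
rewrite unfold_in /embed comp_mpolyD rmorphM.
exact: ((smem_closed J).2 (embed c) _ _ gP hP).
Qed.

(** The contraction of J along the inclusion of R_i into Q. *)
Definition embed_pre (i : 'I_r) J : submodule (R i)^o := Submodule (embed_pre_closed i J).

Lemma embedX (i : 'I_r) j : embed ('X_j : R i) = 'X_(tagnat.Rank i j) :> Q.
Proof. by rewrite /embed comp_mpolyXU -tnth_nth tnth_mktuple. Qed.

Lemma xx_sub (i : 'I_r) : {subset xx K n i <= var_ideal (fun k => grp k == i)}.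
Proof.
apply: span_sub => _ [f fi ->]; apply: (@span_sub _ _ _ (embed_pre i (var_ideal (fun k => grp k == i)))) fi.
move=> _ [j ->]; change ((embed 'X_j : Q^o) \in var_ideal (fun k => grp k == i)).
by rewrite embedX -[X in X \in _]mulr1; apply: mulX_var_ideal; rewrite /grp tagnat.Rank1K.
Qed.

Lemma xxX k : ('X_k : Q^o) \in xx K n (grp k).
Proof.
apply: mem_span; exists 'X_(tagnat.sig2 k); last by rewrite embedX tagnat.sig2K.
by apply: mem_span; exists (tagnat.sig2 k).
Qed.

Lemma xx_others_ideal i j : i != j -> {subset xx K n i <= others_ideal j}.
Proof.
by move=> ij q /xx_sub; apply: var_ideal_sub => k /eqP ki; rewrite /outside ki.
Qed.

Lemma avoids_outside2 i j m : i != j -> avoids (outside i) m -> avoids (outside j) m -> m = 0%MM.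
Proof.
move=> ij /forall_inP mi /forall_inP mj; apply/mnmP => k; rewrite mnm0E; apply/eqP.
have [ki|] := eqVneq (grp k) i; last exact: mi.
by apply: mj; rewrite /outside ki.
Qed.

Lemma avoids_outside0 i : avoids (outside i) 0%MM.
Proof. by apply/forall_inP => k _; rewrite mnm0E. Qed.

(** The ideal L is the intersection of the ideals X_i generated by the variables
    outside the i-th group: a monomial in all of them involves two groups. *)
Lemma ideal_LP (hr : (0 < r)%N) (q : Q) :
  reflect (forall i, (q : Q^o) \in others_ideal i) ((q : Q^o) \in ideal_L K n).
Proof.
apply: (iffP idP) => [qL i|qX].
  suff: {subset ideal_L K n <= others_ideal i} by apply.
  apply: span_sub => p [j [j' [jj' pj pj']]].
  have [ji|ji] := eqVneq j i; last exact: xx_others_ideal pj.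
  by apply: xx_others_ideal pj'; rewrite -ji eq_sym.
apply: mem_ideal_mnm => m qm.
have ex i : exists2 k, grp k != i & m k != 0%N.
  have /forall_inPn[k ki mk] : ~~ avoids (outside i) m by apply: contra qm => mi; apply/eqP/(var_idealP _ _ (qX i)).
  by exists k.
have [k _ mk] := ex (Ordinal hr); have [k' kk' mk'] := ex (grp k).
apply: mem_span; exists (grp k), (grp k'); split; first by rewrite eq_sym.
  exact: mem_ideal_mnmX mk (xxX k).
exact: mem_ideal_mnmX mk' (xxX k').
Qed.

(** A monomial of degree at most 1 involves at most one group of variables. *)
Lemma others_ideal_low (q : Q) d : (0 < r)%N -> hom d q -> d <= 1 ->
  (forall i, (q : Q^o) \in others_ideal i) -> q = 0.
Proof.
move=> hr qd d1 qX; apply/mpolyP => m; rewrite mcoeff0.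
apply/eqP; apply: contraT => qm; have md := qd m qm.
have [i mi] : exists i, avoids (outside i) m; last by apply: contraNT qm => _; apply/eqP/(var_idealP _ _ (qX i)).
have : (mdeg m <= 1)%N by rewrite -lez_nat md.
rewrite leq_eqVlt ltnS leqn0 mdeg_eq0 => /orP[|/eqP->]; last first.
  by exists (Ordinal hr); apply: avoids_outside0.
move=> /mdeg1P[k /eqP ->]; exists (grp k); apply/forall_inP => k'.
by rewrite /outside mnm1E; case: (k =P k') => [->|//]; rewrite eqxx.
Qed.

(** Keep in each q i the part in the variables of the i-th group, add these
    parts and correct the constant term, which has been counted r times. This is
    why the fiber product over K is a quotient of Q. *)
Lemma glue (q : 'I_r -> Q) : (0 < r)%N ->
  (forall i j, (q i - q j : Q^o) \in var_ideal predT) ->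
  exists2 g, (forall s, (forall i, hom s (q i)) -> hom s g) &
    forall i, (g - q i : Q^o) \in others_ideal i.
Proof.
move=> hr qq; pose i0 := Ordinal hr; pose c := (q i0)@_0.
have qc i : (q i)@_0 = c.
  by have /var_ideal_allP/eqP := qq i i0; rewrite mcoeffB subr_eq0 => /eqP.
exists (c%:MP + \sum_i (trunc (avoids (outside i)) (q i) - c%:MP)).
  move=> s qs; have cs : hom s (c%:MP : Q).
    have [->|s0] := eqVneq s 0; first exact: homC.
    by rewrite /c (hom_neq0 (qs i0) s0) mpolyC0; apply: hom0.
  apply: homD => //; apply: hom_sum => i _; apply: homB => // m.
  by rewrite mcoeff_trunc; case: ifP => _; [apply: qs|rewrite eqxx].
move=> i; apply/var_idealP => m mi; rewrite mcoeffB mcoeffD raddf_sum /= mcoeffC.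
have [->|m0] := eqVneq m 0%MM.
  rewrite qc mulr1 big1 ?addr0 ?subrr // => j _.
  by rewrite mcoeffB mcoeff_trunc avoids_outside0 qc mcoeffC eqxx mulr1 subrr.
rewrite mulr0 add0r (bigD1 i) //= mcoeffB mcoeff_trunc mi mcoeffC (negbTE m0) mulr0 subr0.
rewrite [X in _ + X - _]big1 ?addr0 ?subrr // => j ji.
rewrite mcoeffB mcoeff_trunc mcoeffC (negbTE m0) mulr0 subr0; case: ifP => // mj.
by rewrite (avoids_outside2 ji mj mi) eqxx in m0.
Qed.

Variable a : forall i, submodule (R i)^o.
Hypothesis a_homog : forall i, homogeneous_ideal (a i).
Hypothesis a_sq : forall i, {subset a i <= ideal_mul (@irrelevant K (n i)) (@irrelevant K (n i))}.

Lemma others_ideal_A i : {subset others_ideal i <= ideal_A a i}.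
Proof.
apply: var_ideal_min => k ki; apply: mem_span; right; exists (grp k) => //.
exact: xxX.
Qed.

Lemma ideal_A_var_ideal i : {subset ideal_A a i <= var_ideal predT}.
Proof. by move=> q /(ideal_A_irrelevant a_sq); rewrite irrelevant_var_ideal. Qed.

(** The exponents that A_i misses because a_i lies in the square of the
    irrelevant ideal. *)
Definition linear_in (i : 'I_r) : pred 'X_{1..N} := fun m => (mdeg m <= 1)%N && avoids (outside i) m.

Lemma linear_in_down i : downclosed (linear_in i).
Proof.
move=> m1 m2 /andP[m1' m2']; apply/andP; split; last exact: avoids_down m2'.
by apply: leq_trans m1'; rewrite mdegD leq_addl.
Qed.

Lemma ideal_A_linear i : {subset ideal_A a i <= omit_ideal (K := K) (@linear_in_down i)}.
Proof.
apply: span_sub => q [|[j ji /(xx_others_ideal ji)/var_idealP q0]]; last first.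
  by apply/omit_idealP => m /andP[_ /q0].
move: q; apply: span_sub => _ [f /a_sq fa ->].
apply: (@span_sub _ _ _ (embed_pre i (omit_ideal (@linear_in_down i)))) fa.
move=> _ [g [h [gi hi ->]]]; change ((embed (g * h) : Q^o) \in omit_ideal (K := K) (@linear_in_down i)).
have irr (p : R i) : (p : (R i)^o) \in (irrelevant : submodule (R i)^o) -> (embed p : Q)@_0 = 0.
  by move=> /embed_irrelevant; rewrite irrelevant_var_ideal => /var_ideal_allP.
apply/omit_idealP => m /andP[m1 _]; rewrite /embed rmorphM.
apply: contraTeq m1 => /mcoeffM_neq0[m1 [m2 [-> gm hm]]].
have nz (p : R i) m' : (p : (R i)^o) \in (irrelevant : submodule (R i)^o) ->
    (embed p : Q)@_m' != 0 -> (0 < mdeg m')%N.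
  by move=> /irr p0; apply: contraNT; rewrite -leqNgt leqn0 mdeg_eq0 => /eqP->; rewrite p0.
by rewrite mdegD -ltnNge; apply: (@leq_add 1 1); [apply: nz gm|apply: nz hm].
Qed.

Lemma ideal_A_low i d (q : Q) : hom d q -> d <= 1 ->
  (q : Q^o) \in ideal_A a i -> (q : Q^o) \in others_ideal i.
Proof.
move=> qd d1 /ideal_A_linear/omit_idealP q0; apply/var_idealP => m mi.
apply/eqP; apply: contraT => qm; have md := qd m qm; case/eqP: qm; apply: q0.
by rewrite /linear_in mi andbT -lez_nat md.
Qed.

Lemma hom_embedX i m : hom (mdeg m) (embed ('X_[m] : R i) : Q).
Proof.
rewrite /embed comp_mpolyX mdegE (big_morph Posz PoszD (erefl _)).
apply: hom_prod => j; rewrite tnth_mktuple.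
have := @hom_exp K N 1 'X_(tagnat.Rank i j) (m j); rewrite natz; apply.
by have := @homX K N U_(tagnat.Rank i j)%MM; rewrite mdeg1.
Qed.

Lemma hcomp_embed i d (f : R i) : hcomp d%:Z (embed f : Q) = embed (pihomog mdeg d f).
Proof.
rewrite pihomogE /embed comp_mpolyEX [in LHS]raddf_sum [in RHS]raddf_sum /= [RHS]big_mkcond /=.
apply: eq_bigr => m _; rewrite comp_mpolyZ linearZ /=.
case: ifP => [/eqP <-|md]; first by rewrite (hcomp_id (@hom_embedX i m)).
by rewrite (hcomp0 (@hom_embedX i m)) ?scaler0 // eq_sym eqz_nat md.
Qed.

(** The ideal a_i stays homogeneous in Q because the inclusion of R_i preserves
    degrees ([hcomp_embed]). *)
Lemma homogeneous_A i : homogeneous (ideal_A a i).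
Proof.
apply: homogeneous_span => d q [qa|[j ji qj]]; last first.
  by apply: others_ideal_A; apply: homogeneous_omit; apply: xx_others_ideal qj.
apply: mem_span; left; move: d q qa; apply: homogeneous_span => d _ [f fa ->].
case: d => d; last first.
  rewrite (_ : hcomp _ _ = 0) ?rpred0 //.
  exact: (hom_lt0 (@hcomp_hom K N (Negz d) _)).
by rewrite hcomp_embed; apply: mem_span; exists (pihomog mdeg d f) => //; apply: a_homog.
Qed.

Lemma homogeneous_L : (0 < r)%N -> homogeneous (ideal_L K n).
Proof.
by move=> hr d q /(ideal_LP hr) qL; apply/(ideal_LP hr) => i; apply: (@homogeneous_omit _ _ _ _ _ _ (qL i)).
Qed.

Lemma L_sub_A i : (0 < r)%N -> {subset ideal_L K n <= ideal_A a i}.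
Proof. by move=> hr q /(ideal_LP hr) qL; apply: others_ideal_A. Qed.

End Ideals.

(** * Comparison of the fiber product with its factors *)

Section Comparison.
Context (K : fieldType) {r : nat} (hr : (0 < r)%N) (n : 'I_r -> nat).
Local Notation N := (\sum_i n i)%N.
Local Notation R i := {mpoly K[n i]}.
Local Notation Q := {mpoly K[N]}.
Variable a : forall i, submodule (R i)^o.
Hypothesis a_sq : forall i, {subset a i <= ideal_mul (@irrelevant K (n i)) (@irrelevant K (n i))}.
Variable F : gres (residue K n).
Notation QF := (tens (gring (K := K) (N := N)) F).

Local Notation A := (ideal_A a).
Local Notation I := (inter (ideal_A a)).
Local Notation L := (ideal_L K n).

(** In degree at most 1 the ideal I agrees with the intersection of the X_i,
    which has no such elements. *)
Lemma inter_A_low (q : Q) d : hom d q -> d <= 1 -> (q : Q^o) \in I -> q = 0.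
Proof.
move=> qd d1 /interP qA; apply: (others_ideal_low hr qd d1) => i.
exact: (ideal_A_low a_sq qd d1 (qA i)).
Qed.

Lemma within_interP (J : 'I_r -> submodule Q^o) t (z : QF t) :
  within (inter J) z <-> forall i, within (J i) z.
Proof.
split=> [zI i k|zJ k]; first by have /interP := zI k.
by apply/interP => i; apply: zJ.
Qed.

Lemma cyc_interP (J : 'I_r -> submodule Q^o) t (z : QF t) :
  cyc (inter J) z <-> forall i, cyc (J i) z.
Proof. by case: t z => [|t] z //; apply: within_interP. Qed.

Lemma within_glue s t (q : 'I_r -> QF t) : (forall i, homs s (q i)) ->
  (forall i j, within (var_ideal predT) (q i - q j)) ->
  exists2 g, homs s g & forall i, within (others_ideal K n i) (g - q i).
Proof.
move=> qs qq.
have /choice[g gP] k : exists g, hom (s - dg (g := F) k) g /\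
    forall i, (g - (q i k : Q) : Q^o) \in others_ideal K n i.
  have [i j|g gs gq] := @glue K r n (fun i => q i k : Q) hr.
    exact: (qq i j k).
  by exists g; split=> //; apply: gs => i; apply: qs.
exists (g : QF t) => [k|i k]; first by have [] := gP k.
by have [_] := gP k; apply.
Qed.

(** [Tor_(t+1)(Q/I, K)]_s embeds in [Tor_t(I, K)]_s, which is zero for
    s <= t + 1 since I then vanishes in degree s - t. *)
Lemma fiber_bnd_low s t (z : QF t.+1) : s <= t.+1%:Z -> homs s z -> cyc I z -> bnd I s z.
Proof.
move=> st zs zc.
have I0 (q : Q) : hom (s - t%:Z) q -> (q : Q^o) \in I -> (q : Q^o) \in var_ideal pred0.
  move=> qs /(inter_A_low qs) ->; first exact: rpred0.
  by rewrite lerBlDr addrC -[1]/(1%:Z) -PoszD addn1.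
have [w [ws wI wz]] := concentrated I0 (homs_tdif zs) zc (cyc_tdif _ _).
have [||v vs vE] := @strand_exact K N _ F s t (z - w).
- exact: homsB.
- apply/functional_extensionality_dep => k; apply: var_ideal_none.
  by have := wz k; rewrite raddfB.
by exists v => //; rewrite -vE opprB addrCA subrr addr0.
Qed.

(** Surjectivity onto the Tor of the factors: as Tor_t(K, K)_s = 0, cycles of
    the factors can be changed by boundaries so as to vanish modulo m, and then
    glued. *)
Lemma fiber_cyc_lift s t (z : 'I_r -> QF t) : s != t%:Z ->
  (forall i, homs s (z i)) -> (forall i, cyc (A i) (z i)) ->
  exists y : QF t, [/\ homs s y, cyc I y & forall i, bnd (A i) s (z i - y)].
Proof.
move=> st zs zc.
have bi i : bnd (var_ideal predT) s (z i).
  by apply: koszul_const => //; apply: cyc_sub (zc i); apply: ideal_A_var_ideal.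
have /choice[v vP] i : exists v : QF t.+1, homs s v /\ within (var_ideal predT) (z i - tdif v).
  by have [v] := bi i; exists v.
have vs i : homs s (v i) by have [] := vP i.
have [i|i j|y ys yq] := @within_glue s t (fun i => z i - tdif (v i)).
- by apply: homsB => //; apply: homs_tdif.
- by apply: withinB; [have [] := vP i|have [] := vP j].
have yA i : within (A i) (y - (z i - tdif (v i))).
  exact: sub_within (@others_ideal_A K r n a i) (yq i).
exists y; split=> // [|i]; last first.
  by exists (v i) => //; rewrite addrAC; apply: within_sym.
apply/cyc_interP => i; rewrite -[y](subrK (z i - tdif (v i))).
by apply: cycD; [apply: cyc_within|apply: cycB => //; apply: cyc_tdif].
Qed.

(** Injectivity: the bounding vectors v i of the factors differ modulo m by
    cycles, hence by boundaries as Tor_(t+1)(K, K)_s = 0. Corrected by these they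
    agree modulo m and glue. *)
Lemma fiber_bnd s t (z : QF t) : s != t.+1%:Z ->
  homs s z -> (forall i, bnd (A i) s z) -> bnd I s z.
Proof.
move=> st zs zb.
have /choice[v vP] i : exists v : QF t.+1, homs s v /\ within (A i) (z - tdif v).
  by have [v] := zb i; exists v.
have vs i : homs s (v i) by have [] := vP i.
have vz i : within (A i) (z - tdif (v i)) by have [] := vP i.
have vz0 i : within (var_ideal predT) (z - tdif (v i)) by apply: sub_within (vz i); apply: ideal_A_var_ideal.
pose i0 := Ordinal hr.
have bi i : bnd (var_ideal predT) s (v i - v i0).
  apply: koszul_const => //; first exact: homsB.
  by rewrite /= raddfB; apply: within_trans (within_sym (vz0 i)) (vz0 i0).
have /choice[w wP] i : exists w : QF t.+2, homs s w /\ within (var_ideal predT) (v i - v i0 - tdif w).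
  by have [w] := bi i; exists w.
have qq i : within (var_ideal predT) (v i - tdif (w i) - v i0).
  by have [_] := wP i; rewrite addrAC.
have [i|i j|y ys yq] := @within_glue s t.+1 (fun i => v i - tdif (w i)).
- by apply: homsB => //; apply: homs_tdif; have [] := wP i.
- exact: within_trans (qq i) (within_sym (qq j)).
exists y => //; apply/within_interP => i.
apply: within_trans (vz i) _; apply: within_sym.
have := within_tdif (sub_within (@others_ideal_A K r n a i) (yq i)).
by rewrite !raddfB /= tdif_tdif opprK addr0.
Qed.

(** Tor_t(Q/L) -> Tor_t(Q/I) is injective in degree t + 1: its kernel comes from
    Tor_t(I/L, K)_(t+1), which is zero because I/L vanishes in degree 1. *)
Lemma L_bnd t (z : QF t) : homs (t%:Z + 1) z -> cyc L z ->
  bnd I (t%:Z + 1) z -> bnd L (t%:Z + 1) z.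
Proof.
move=> zs zc [v vs vI].
have I0 (q : Q) : hom (t%:Z + 1 - t%:Z) q -> (q : Q^o) \in I -> (q : Q^o) \in L.
  move=> qs /(inter_A_low qs) -> //; first exact: rpred0.
  by rewrite addrAC subrr.
have [||w [ws wI wz]] := concentrated I0 _ vI.
- by apply: homsB => //; apply: homs_tdif.
- by apply: cycB => //; apply: cyc_tdif.
exists (v + w); first exact: homsD.
by rewrite raddfD opprD addrA.
Qed.

(** The map Tor_t(Q/L) -> Tor_t(Q/A_i) factors through Tor_t(Q/X_i), which is
    zero in degree s by the Koszul property. *)
Lemma L_cyc_bnd_A i s t (z : QF t) : s != t%:Z -> homs s z -> cyc L z -> bnd (A i) s z.
Proof.
move=> st zs zc.
have zc' : cyc (others_ideal K n i) z.
  by apply: cyc_sub zc => q /(ideal_LP hr).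
have E1 : {subset var_ideal (K := K) (outside (n := n) i) <= var_ideal (mem (enum (outside (n := n) i)))}.
  by apply: var_ideal_sub => k ki /=; rewrite mem_enum.
have E2 : {subset var_ideal (K := K) (mem (enum (outside (n := n) i))) <= others_ideal K n i}.
  by apply: var_ideal_sub => k /=; rewrite mem_enum.
apply: bnd_sub (@others_ideal_A K r n a i) _; apply: bnd_sub E2 _.
by apply: koszul => //; apply: cyc_sub zc'.
Qed.

(** If z = tdif (v i) modulo A_i for all i, then the boundaries tdif (v i) agree
    modulo m. The vector glued from them is a cycle modulo every X_i, that is
    modulo L, and it agrees with z modulo I. *)
Lemma fiber_bnd_L t (z : QF t) : homs (t%:Z + 1) z -> (forall i, bnd (A i) (t%:Z + 1) z) ->
  exists y : QF t, [/\ homs (t%:Z + 1) y, cyc L y & within I (z - y)].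
Proof.
set s := _ + 1 => zs zb.
have /choice[v vP] i : exists v : QF t.+1, homs s v /\ within (A i) (z - tdif v).
  by have [v] := zb i; exists v.
have vs i : homs s (v i) by have [] := vP i.
have vz i : within (A i) (z - tdif (v i)) by have [] := vP i.
have vz0 i : within (var_ideal predT) (z - tdif (v i)) by apply: sub_within (vz i); apply: ideal_A_var_ideal.
have [i|i j|y ys yq] := @within_glue s t (fun i => tdif (v i)).
- exact: homs_tdif.
- exact: within_trans (within_sym (vz0 i)) (vz0 j).
exists y; split=> //; last first.
  apply/within_interP => i; apply: within_trans (vz i) _; apply: within_sym.
  exact: sub_within (@others_ideal_A K r n a i) (yq i).
have yX i : cyc (others_ideal K n i) y.
  by rewrite -[y](subrK (tdif (v i))); apply: cycD; [apply: cyc_within|apply: cyc_tdif].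
have : cyc (inter (others_ideal K n)) y by apply/cyc_interP.
by apply: cyc_sub => q /interP qX; apply/ideal_LP.
Qed.

End Comparison.

(** * Tor of a cyclic module by cycles and boundaries modulo its ideal *)

(** Scalars of K act on graded pieces through constant polynomials, so a
    map that is K-linear up to this identification descends to the pieces. *)
Lemma piece_quot_linear (K : fieldType) (N : nat) (M : gmod (K := K) (N := N))
    (S : submodule M) s (Z : lmodType K) (g : Z -> M)
    (gS : forall z, (quo_proj S (g z) : restr (quo S)) \in smem (gdeg (gquot M S) s)) :
  (forall c x y, g (c *: x + y) = c%:MP *: g x + g y) ->
  linear (fun z => exist (fun x => x \in smem (gdeg (gquot M S) s)) _ (gS z)
          : piece (gquot M S) s).
Proof.
move=> gl c x y; apply: val_inj.
rewrite -[LHS]/(quo_proj S (g (c *: x + y))) gl.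
exact: (linearP (quo_proj S)).
Qed.

Section Presentation.
Context {K : fieldType} {N : nat}.
Local Notation Q := {mpoly K[N]}.
Variables (L0 : gmod (K := K) (N := N)) (F : gres L0).
Notation QF := (tens (gring (K := K) (N := N)) F).

Definition strand_cycles_pred (J : submodule Q^o) s t : {pred restr (QF t)} :=
  fun z => `[< homs s (z : QF t) /\ cyc J (z : QF t) >].

Fact strand_cycles_closed J s t : submod_closed (@strand_cycles_pred J s t).
Proof.
split=> [|c x y /asboolP[xs xc] /asboolP[ys yc]]; apply/asboolP.
  by split=> [j|]; [apply: hom0|apply/cyc_within/within0].
have -> : c *: x + y = c%:MP *: (x : QF t) + (y : QF t) by [].
split.
  by apply: homsD => //; rewrite -[s]add0r; apply: homsM => //; apply: homC.
apply: cycD => //; case: t x y {xs ys yc} xc => // t x _ xc /= k.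
by rewrite linearZ; apply: (idealM c%:MP (xc k)).
Qed.

(** The space of which [Tor_t(Q/J, K)]_s is the quotient by [bnd J s]. *)
Definition strand_cycles J s t := Submodule (@strand_cycles_closed J s t).

Variables (M : gmod (K := K) (N := N)) (f : {linear Q^o -> M}) (J : submodule Q^o).
Hypothesis fdeg : forall s (q : Q), hom s q -> (f q : restr M) \in gdeg M s.
Hypothesis flift : forall s (m : M), (m : restr M) \in gdeg M s ->
  exists q : Q, hom s q /\ f q = m.
Hypothesis fsurj : forall m : M, exists q : Q, f q = m.
Hypothesis fker : forall q : Q, f q = 0 <-> (q : Q^o) \in J.
Hypothesis Jhom : homogeneous J.

Definition tmap t (z : QF t) : tens M F t := fun j => f (z j).

Lemma tmapP t q (x y : QF t) : tmap (q *: x + y) = q *: tmap x + tmap y.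
Proof.
apply/functional_extensionality_dep => j.
change (f (q *: (x j : Q^o) + (y j : Q^o)) = q *: f (x j) + f (y j)).
exact: linearP.
Qed.

Lemma tmap_tdif t (z : QF t.+1) : tmap (tdif z) = tdif (tmap z).
Proof.
apply/functional_extensionality_dep => k; rewrite /tmap /tdif.
rewrite -[LHS]/(f (\sum_j dif F t j k *: (z j : Q^o))) linear_sum.
by apply: eq_bigr => j _; rewrite linearZ.
Qed.

Lemma tmap_eq0 t (z : QF t) : tmap z = 0 <-> within J z.
Proof.
split=> [z0 k|zJ]; first by apply/fker; apply: (congr1 (fun x : tens M F t => x k) z0).
by apply/functional_extensionality_dep => k; apply/fker/zJ.
Qed.

Lemma tmap_cycles t (z : QF t) : (tmap z \in cycles M F t) <-> cyc J z.
Proof.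
case: t z => [|t] z; first by [].
split=> [/eqP zc|zc]; first by apply/tmap_eq0; rewrite tmap_tdif.
by apply/eqP; rewrite -tmap_tdif; apply/tmap_eq0.
Qed.

Lemma tmap_lift t (x : tens M F t) : exists z : QF t, tmap z = x.
Proof.
have /choice[z zx] j : exists q : Q, f q = x j by apply: fsurj.
by exists z; apply/functional_extensionality_dep => j; apply: zx.
Qed.

Lemma tmap_lift_deg s t (x : tens M F t) : (x : restr (tens M F t)) \in gdeg (tens M F t) s ->
  exists z : QF t, homs s z /\ tmap z = x.
Proof.
move=> /forallP xs.
have /choice[z zx] j : exists q : Q, hom (s - dg (g := F) j) q /\ f q = x j by apply/flift/xs.
exists z; split=> [j|]; first by have [] := zx j.
by apply/functional_extensionality_dep => j; have [] := zx j.
Qed.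

Lemma hcomps_within s t (z : QF t) : within J z -> within J (hcomps s z).
Proof. by move=> zJ k; apply: Jhom; apply: zJ. Qed.

(** Boundaries in M (x) F are unrestricted, those of [bnd] homogeneous; the two
    notions agree because J is homogeneous. *)
Lemma tmap_bnd s t (z : QF t) : homs s z ->
  ((exists x, tmap z = tdif x) <-> bnd J s z).
Proof.
move=> zs; split=> [[x zx]|[v vs vJ]]; last first.
  exists (tmap v); rewrite -tmap_tdif; apply/eqP; rewrite -subr_eq0; apply/eqP.
  have -> : tmap z - tmap (tdif v) = tmap (z - tdif v).
    by apply/functional_extensionality_dep => j; rewrite /tmap linearB.
  exact/tmap_eq0.
have [v vx] := tmap_lift x; exists (hcomps s v); first exact: hcomps_homs.
rewrite hcomps_tdif -{1}(hcomps_id zs).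
have -> : hcomps s z - hcomps s (tdif v) = hcomps s (z - tdif v).
  by apply/functional_extensionality_dep => j; rewrite /hcomps linearB.
apply: hcomps_within; apply/tmap_eq0.
have -> : tmap (z - tdif v) = tmap z - tmap (tdif v).
  by apply/functional_extensionality_dep => j; rewrite /tmap linearB.
by rewrite tmap_tdif vx zx subrr.
Qed.

Variables (s : int) (t : nat).
Local Notation Z := (subm (strand_cycles J s t)).

Lemma strand_cyclesP (z : Z) : homs s (val z : QF t) /\ cyc J (val z : QF t).
Proof. by apply/asboolP; apply: (valP z). Qed.

Definition tor_cycle (z : Z) : subm (cycles M F t) :=
  exist _ (tmap (val z : QF t)) ((tmap_cycles _).2 (strand_cyclesP z).2).

Fact tor_class_deg (z : Z) :
  (quo_proj (boundaries M F t) (tor_cycle z) : restr (Tor M F t)) \in smem (gdeg (Tor M F t) s).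
Proof.
apply/asboolP; exists (tor_cycle z) => //; apply/forallP => j.
by apply: fdeg; have [zs _] := strand_cyclesP z; apply: zs.
Qed.

Definition tor_class (z : Z) : piece (Tor M F t) s :=
  exist (fun x => x \in smem (gdeg (Tor M F t) s)) _ (tor_class_deg z).

Fact tor_cycle_linear (c : K) (x y : Z) :
  tor_cycle (c *: x + y) = c%:MP *: tor_cycle x + tor_cycle y.
Proof.
pose V : subm (cycles M F t) -> tens M F t := val.
have VP u v : V (c%:MP *: u + v) = c%:MP *: V u + V v by exact: linearP.
by apply: (val_inj : injective V); rewrite VP /V /= -[RHS]tmapP.
Qed.

Fact tor_class_linear : linear tor_class.
Proof. exact: (piece_quot_linear (M := gsub (tens M F t) (cycles M F t)) tor_class_deg tor_cycle_linear). Qed.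
HB.instance Definition _ := GRing.isLinear.Build K Z (piece (Tor M F t) s) _ tor_class tor_class_linear.

Lemma tor_class_eq0 (z : Z) : tor_class z = 0 <-> bnd J s (val z : QF t).
Proof.
have [zs _] := strand_cyclesP z; split=> [z0|].
  have /quot_eq0/asboolP[x xz] : \pi_(quo (boundaries M F t)) (tor_cycle z) = 0.
    exact: (congr1 val z0).
  by apply/(tmap_bnd zs); exists x.
move=> /(tmap_bnd zs)[x xz]; apply: val_inj; apply/quot_eq0/asboolP.
by exists x.
Qed.

Lemma tor_class_surj (y : piece (Tor M F t) s) : exists z, tor_class z = y.
Proof.
have /asboolP[m ms ym] := valP y.
have [z [zs zm]] := tmap_lift_deg ms.
have zc : cyc J z by apply/tmap_cycles; rewrite zm; apply: (valP m).
exists (exist _ (z : restr (QF t)) (asboolT (conj zs zc)) : Z).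
apply: val_inj; rewrite ym; congr (\pi_(quo (boundaries M F t)) _).
exact: val_inj.
Qed.

(** All that is needed of [Tor_t(M, K)]_s for a cyclic module M = Q/J: it is
    cycles modulo boundaries, both taken over Q. *)
Lemma tor_presentation : exists c : {linear Z -> piece (Tor M F t) s},
  (forall y, exists z, c z = y) /\ (forall z, c z = 0 <-> bnd J s (val z : QF t)).
Proof.
exists tor_class; split; [exact: tor_class_surj|exact: tor_class_eq0].
Qed.

End Presentation.

Lemma strand_cycles_sub (K : fieldType) (N : nat) (L0 : gmod (K := K) (N := N)) (F : gres L0)
    (J J' : submodule {mpoly K[N]}^o) s t :
  {subset J <= J'} -> {subset strand_cycles F J s t <= strand_cycles F J' s t}.
Proof.
move=> JJ' z /asboolP[zs zc]; apply/asboolP; split=> //; exact: cyc_sub zc.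
Qed.

Section CyclicQuotient.
Context {K : fieldType} {N : nat} (J : submodule {mpoly K[N]}^o).
Local Notation Q := {mpoly K[N]}.
Local Notation M := (gquot gring J).

Lemma quo_proj_deg s (q : Q) : hom s q -> (quo_proj J q : restr M) \in gdeg M s.
Proof. by move=> qs; apply/asboolP; exists q => //; apply/homP. Qed.

Lemma quo_proj_lift s (m : M) : (m : restr M) \in gdeg M s ->
  exists q : Q, hom s q /\ quo_proj J q = m.
Proof. by move=> /asboolP[q /homP qs ->]; exists q. Qed.

Lemma quo_proj_surj (m : M) : exists q : Q, quo_proj J q = m.
Proof. by exists (repr m); rewrite /quo_proj reprK. Qed.

Lemma quo_proj_ker (q : Q) : quo_proj J q = 0 <-> (q : Q^o) \in J.
Proof. exact: quot_eq0. Qed.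

End CyclicQuotient.

(** * The fiber product as a cyclic module, and its Tor *)

Section FiberProduct.
Context (K : fieldType) {r : nat} (hr : (0 < r)%N) (n : 'I_r -> nat).
Local Notation N := (\sum_i n i)%N.
Local Notation R i := {mpoly K[n i]}.
Local Notation Q := {mpoly K[N]}.
Variable a : forall i, submodule (R i)^o.
Hypothesis a_sq : forall i, {subset a i <= ideal_mul (@irrelevant K (n i)) (@irrelevant K (n i))}.
Local Notation P := (fiber_product a_sq).
Local Notation fib := (fiber (fun i => qproj (ideal_A_irrelevant a_sq (i := i)))).

Fact fiber_proj_proof (q : Q^o) : dirsum_map (fun i => quo_proj (ideal_A a i)) q \in smem fib.
Proof. by apply/fiberP => i j; rewrite /= /dirsum_map /= /quo_proj !qproj_pi. Qed.

Definition fiber_proj (q : Q^o) : P :=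
  exist (fun x => x \in smem fib) _ (fiber_proj_proof q).

Fact fiber_proj_linear : linear fiber_proj.
Proof. by move=> c x y; apply: val_inj; apply: (linearP (dirsum_map _)). Qed.
HB.instance Definition _ := GRing.isLinear.Build Q Q^o P _ fiber_proj fiber_proj_linear.

Lemma fiber_proj_deg s (q : Q) : hom s q -> (fiber_proj q : restr P) \in gdeg P s.
Proof. by move=> qs; apply/forallP => i; apply: quo_proj_deg. Qed.

(** Representatives of the coordinates of m agree modulo the irrelevant ideal,
    so they can be glued: Q maps onto the fiber product. *)
Lemma fiber_glue (m : P) (q : 'I_r -> Q) : (forall i, val m i = quo_proj (ideal_A a i) (q i)) ->
  exists2 g, (forall s, (forall i, hom s (q i)) -> hom s g) & fiber_proj g = m.
Proof.
move=> mq; have [i j|g gs gq] := @glue K r n q hr.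
  rewrite -irrelevant_var_ideal; have /fiberP/(_ i j) := valP m.
  by rewrite /= !mq /= /quo_proj !qproj_pi => /eqP; rewrite -idealrBE.
exists g => //; apply: val_inj; apply/functional_extensionality_dep => i /=.
rewrite mq; apply/eqP; rewrite -subr_eq0; apply/eqP.
rewrite -[LHS]/(quo_proj (ideal_A a i) g - quo_proj (ideal_A a i) (q i)) -linearB.
exact/quo_proj_ker/others_ideal_A/gq.
Qed.

Lemma fiber_proj_lift s (m : P) : (m : restr P) \in gdeg P s ->
  exists q : Q, hom s q /\ fiber_proj q = m.
Proof.
move=> /forallP ms; have /choice[q qP] i := quo_proj_lift (ms i).
have [i|g gs gm] := @fiber_glue m q; first by have [_ ->] := qP i.
by exists g; split=> //; apply: gs => i; have [] := qP i.
Qed.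

Lemma fiber_proj_surj (m : P) : exists q : Q, fiber_proj q = m.
Proof.
have /choice[q qP] i := quo_proj_surj (val m i).
by have [i|g _ gm] := @fiber_glue m q; [rewrite qP|exists g].
Qed.

Lemma fiber_proj_ker (q : Q) : fiber_proj q = 0 <-> (q : Q^o) \in inter (ideal_A a).
Proof.
split=> [q0|/interP qA].
  apply/interP => i; apply/quo_proj_ker.
  exact: (congr1 (fun m : P => val m i) q0).
by apply: val_inj; apply/functional_extensionality_dep => i; apply/quo_proj_ker/qA.
Qed.

End FiberProduct.

Theorem theorem3p13 (K : fieldType) (r : nat) (hr : (2 <= r)%N)
    (n : 'I_r -> nat) (hn : forall i, (1 <= n i)%N)
    (a : forall i, submodule {mpoly K[n i]}^o)
    (a_homog : forall i, homogeneous_ideal (a i))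
    (a_sq : forall i, {subset a i <= ideal_mul irrelevant irrelevant})
    (F : gres (residue K n)) (t : nat) (ht : (1 <= t)%N) (s : int) :
  let TorP := Tor (fiber_product a_sq) F t in
  let TorA i := Tor (factor a i) F t in
  let TorL := Tor (gquot gring (ideal_L K n)) F t in
  [/\ s <= t%:Z -> isomorphic (piece TorP s) 'rV[K]_0,
      s = t%:Z + 1 ->
        isomorphic (piece TorP s)
          (dirsum (fun i => piece (TorA i) (t%:Z + 1)) * piece TorL (t%:Z + 1))%type
    & t%:Z + 2 <= s ->
        isomorphic (piece TorP s) (dirsum (fun i => piece (TorA i) s))].
Proof.
move=> TorP TorA TorL; have r0 : (0 < r)%N by apply: ltnW.
pose A := ideal_A a; pose I := inter A; pose L := ideal_L K n.
have Ahom i : homogeneous (A i) by apply: homogeneous_A.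
have Ihom : homogeneous I by apply: homogeneous_inter.
have Lhom : homogeneous L by apply: homogeneous_L.
have IA i : {subset I <= A i} by move=> q /interP; apply.
have LI : {subset L <= I} by move=> q qL; apply/interP => i; apply: L_sub_A.
(* V is the space of cycles modulo J by boundaries modulo J, in degree u. *)
pose pres J u (V : lmodType K) (c : {linear subm (strand_cycles F J u t) -> V}) :=
  (forall y, exists z, c z = y) /\
  (forall z, c z = 0 <-> bnd J u (val z : tens gring F t)).
have presP u : exists c : {linear _ -> piece TorP u}, @pres I u _ c.
  apply: (@tor_presentation _ _ _ F (fiber_product a_sq) (fiber_proj a_sq) I).
  - exact: fiber_proj_deg.
  - exact: fiber_proj_lift.
  - exact: fiber_proj_surj.
  - exact: fiber_proj_ker.
  - exact: Ihom.
have presC (J : submodule {mpoly K[\sum_i n i]}^o) u : homogeneous J ->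
    exists c : {linear _ -> piece (Tor (gquot gring J) F t) u}, @pres J u _ c.
  move=> Jhom; apply: (@tor_presentation _ _ _ F (gquot gring J) (quo_proj J) J) => //.
  - exact: quo_proj_deg.
  - exact: quo_proj_lift.
  - exact: quo_proj_surj.
  - exact: quo_proj_ker.
have presA i u : {c : {linear _ -> piece (TorA i) u} | @pres (A i) u _ c}.
  by apply: cid; apply: presC.
have presL u : exists c : {linear _ -> piece TorL u}, @pres L u _ c by apply: presC.
have sub i u : {subset strand_cycles F I u t <= strand_cycles F (A i) u t}.
  exact: strand_cycles_sub.
pose q u : {linear subm (strand_cycles F I u t) -> dirsum (fun i => piece (TorA i) u)} :=
  dirsum_map (fun i => sval (presA i u) \o incl (sub i u) : {linear _ -> _}).
have q0 u z : q u z = 0 <-> forall i, bnd (A i) u (val z : tens gring F t).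
  split=> [z0 i|zb].
    by apply/((svalP (presA i u)).2 (incl (sub i u) z)); apply: (congr1 (fun x => x i) z0).
  by apply/functional_extensionality_dep => i; apply/((svalP (presA i u)).2 _).
have qs u : u != t%:Z -> forall y, exists z, q u z = y.
  move=> ut y; pose z i := cid ((svalP (presA i u)).1 (y i)).
  have [i|i|x [xs xc xb]] := @fiber_cyc_lift K r r0 n a a_sq F u t (fun i => val (sval (z i))) ut.
  - by have [] := strand_cyclesP (sval (z i)).
  - by have [] := strand_cyclesP (sval (z i)).
  exists (exist _ (x : restr (tens gring F t)) (asboolT (conj xs xc))).
  apply/functional_extensionality_dep => i; apply/eqP; rewrite eq_sym -subr_eq0 -(svalP (z i)).
  rewrite -[X in _ - X]/(sval (presA i u) _) -linearB; apply/eqP/((svalP (presA i u)).2 _).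
  rewrite val_submB; exact: xb.
move=> {presC}; split=> [st|->|ts].
- have [c [cs c0]] := presP s; apply: isomorphic0 => v; have [z <-] := cs v; apply/c0.
  have [zs zc] := strand_cyclesP z; move: (val z) zs zc => {}z.
  case: (t) ht st z => // t' _ st z zs zc; exact: fiber_bnd_low st zs zc.
- have [c [cs c0]] := presP (t%:Z + 1); have [d [ds d0]] := presL (t%:Z + 1).
  pose j := incl (@strand_cycles_sub _ _ _ F L I (t%:Z + 1) t LI) : {linear _ -> _}.
  have t1 : t%:Z + 1 != t%:Z by rewrite -subr_eq0 addrAC subrr.
  apply: (isomorphic_extension cs (qs _ t1) ds (j := j)).
  + move=> z /c0 zb; apply/q0 => i; exact: bnd_sub (IA i) zb.
  + move=> z; apply/q0 => i; have [zs zc] := strand_cyclesP z.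
    exact: L_cyc_bnd_A.
  + move=> z /q0 zb; have [zs zc] := strand_cyclesP z.
    have [y [ys yc yI]] := fiber_bnd_L r0 a_sq zs zb.
    exists (exist _ (y : restr (tens gring F t)) (asboolT (conj ys yc))).
    by apply/c0; rewrite val_submB; apply: within_bnd.
  + move=> z; have [zs zc] := strand_cyclesP z; split=> [/d0 zb|/c0 zb].
      by apply/c0; apply: bnd_sub LI zb.
    by apply/d0; apply: L_bnd zb.
- have [c [cs c0]] := presP s.
  have t0 : s != t%:Z by apply: contraTneq ts => ->; rewrite gerDl.
  have t1 : s != t.+1%:Z by apply: contraTneq ts => ->; rewrite intS [1 + _]addrC lerD2l.
  apply: (isomorphic_same_kernel cs (qs s t0)) => z.
  have [zs zc] := strand_cyclesP z; split=> [/c0 zb|/q0 zb].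
    by apply/q0 => i; apply: bnd_sub (IA i) zb.
  by apply/c0; apply: fiber_bnd.
Qed.
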